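(* Let $\Phi:\mathbb{R}^n\to\mathbb{R}$ be a $2$-homogeneous convex even function, three times continuously differentiable on $\mathbb{R}^n\setminus\{0\}$ with $\det D^2\Phi(x)>0$ for $x\ne0$, and suppose that the probability measure $\mu=\frac{e^{-\Phi}dx}{\int_{\mathbb{R}^n}e^{-\Phi}dx}$ satisfies the strong Brascamp--Lieb inequality $$\mathrm{Var}_\mu f\le\frac12\int_{\mathbb{R}^n}\langle(D^2\Phi)^{-1}\nabla f,\nabla f\rangle\,d\mu$$ for all even $f$. Then $\mu$ is a Gaussian measure (that is, $\Phi$ is a positive definite quadratic form).
   Context: $\mathrm{Var}_\mu f=\int f^2d\mu-(\int f\,d\mu)^2$. $\Phi$ is $2$-homogeneous if $\Phi(tx)=t^2\Phi(x)$ for $t>0$. Test functions $f$ are continuously differentiable and in $L^2(\mu)$ (the right-hand side may be $+\infty$). *)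

(* Defs.v *)
From HB Require Import structures.
From mathcomp Require Import all_boot all_order all_algebra.
From mathcomp Require Import all_classical all_reals all_analysis.

Set Implicit Arguments.
Unset Strict Implicit.
Unset Printing Implicit Defensive.

Import Order.TTheory GRing.Theory Num.Theory.
Import numFieldNormedType.Exports.

Local Open Scope classical_set_scope.
Local Open Scope ring_scope.

Section measurable_rV.
Context {d} {T : sigmaRingType d} (n : nat).

Let coor (i : 'I_n) (x : 'rV[T]_n) : T := x ord0 i.

Let rV_set0 : g_sigma_preimage coor set0.
Proof. exact: sigma_algebra0. Qed.

Let rV_setC A : g_sigma_preimage coor A -> g_sigma_preimage coor (~` A).
Proof. exact: sigma_algebraC. Qed.

Let rV_bigcup (F : (set 'rV[T]_n)^nat) :
  (forall i, g_sigma_preimage coor (F i)) ->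
  g_sigma_preimage coor (\bigcup_i (F i)).
Proof. exact: sigma_algebra_bigcup. Qed.

(* As n.-tuple T in the library, 'rV[T]_n carries the product sigma-algebra,
   generated by the coordinates; for T := R it is the Borel sigma-algebra. *)
HB.instance Definition _ := @isMeasurable.Build (measure_tuple_display d)
  'rV[T]_n (g_sigma_preimage coor) rV_set0 rV_setC rV_bigcup.

End measurable_rV.

Section measurable_rV_lemmas.

Lemma measurable_rV_coord d (T : sigmaRingType d) n (i : 'I_n) :
  measurable_fun [set: 'rV[T]_n] (fun x : 'rV[T]_n => x ord0 i).
Proof.
move=> _ Y mY; rewrite setTI; apply: sub_sigma_algebra => /=.
rewrite -bigcup_seq/=; exists i => /=; first by rewrite mem_index_enum.
by exists Y => //; rewrite setTI.
Qed.

Lemma measurable_fun_rV d1 d2 (T1 : measurableType d1) (T2 : measurableType d2)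
    n (f : T1 -> 'rV[T2]_n) :
  (forall i, measurable_fun [set: T1] (fun x => f x ord0 i)) ->
  measurable_fun [set: T1] f.
Proof.
move=> mf _ A mA; rewrite setTI.
have : preimage_set_system setT f (measurable : set (set 'rV[T2]_n)) (f @^-1` A).
  by exists A => //; rewrite setTI.
rewrite /measurable/= -g_sigma_preimageE.
apply: smallest_sub; first exact: sigma_algebra_measurable.
move=> _ [B + <-]; rewrite -bigcup_seq => -[/= i _ [C mC <-]].
by rewrite setTI setTI; have := mf i measurableT _ mC; rewrite setTI.
Qed.

End measurable_rV_lemmas.

Section lebesgue_rV.
Context {R : realType}.
Local Open Scope ereal_scope.

(* (a, x) |-> (a, x_1, ..., x_n) *)
Definition cons_rV n (p : measurableTypeR R * 'rV[R]_n) : 'rV[R]_n.+1 :=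
  row_mx (const_mx p.1 : 'rV_1) p.2.

Lemma measurable_cons_rV n : measurable_fun setT (@cons_rV n).
Proof.
apply: measurable_fun_rV => i.
rewrite -(splitK (i : 'I_(1 + n))); case: (fintype.split (i : 'I_(1 + n))) => j /=.
- rewrite [X in measurable_fun _ X](_ : _ = fst) //.
  by apply/funext => p; rewrite [LHS](@row_mxEl _ 1 1 n) mxE.
- rewrite [X in measurable_fun _ X](_ : _ = (fun p : R * 'rV[R]_n => p.2 ord0 j)).
    exact: (measurableT_comp (measurable_rV_coord j) measurable_snd).
  by apply/funext => p; rewrite [LHS](@row_mxEr _ 1 1 n).
Qed.

(* n-dimensional Lebesgue measure on the Borel sets of R^n, as the n-fold
   product of the one-dimensional one. *)
Fixpoint lebesgue_rV n : set 'rV[R]_n -> \bar R :=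
  match n with
  | 0 => \d_(0%R : 'rV[R]_0)
  | m.+1 => pushforward (lebesgue_measure \x @lebesgue_rV m) (@cons_rV m)
  end.
Arguments lebesgue_rV n _ : clear implicits.

Definition uncons_rV n (x : 'rV[R]_n.+1) : measurableTypeR R * 'rV[R]_n :=
  (x ord0 ord0, rsubmx (x : 'rV_(1 + n))).

Lemma cons_rVK n : cancel (@cons_rV n) (@uncons_rV n).
Proof.
move=> [a x]; congr (_, _); last by rewrite /= row_mxKr.
transitivity ((const_mx a : 'rV[R]_1) ord0 ord0); last by rewrite mxE.
rewrite -(@row_mxEl _ 1 1 n _ x) /= /cons_rV.
by congr (fun_of_matrix _ _ _); exact: val_inj.
Qed.

Lemma measurable_uncons_rV n : measurable_fun setT (@uncons_rV n).
Proof.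
apply: measurable_fun_pair; first exact: measurable_rV_coord.
apply: measurable_fun_rV => i.
rewrite [X in measurable_fun _ X](_ : _ =
    fun x : 'rV[R]_n.+1 => x ord0 (rshift 1 i : 'I_n.+1)).
  exact: measurable_rV_coord.
by apply/funext => x; rewrite mxE.
Qed.

Lemma lebesgue_rV_sigma_finite_measure n :
  exists m : {sigma_finite_measure set 'rV[R]_n -> \bar R}, lebesgue_rV n = m.
Proof.
elim: n => [|n [m mE]]; first by exists (\d_(0%R : 'rV[R]_0)).
rewrite /= mE.
pose l := @lebesgue_measure R.
pose P := [the {measure set _ -> \bar R} of (l \x m)%E].
pose M := measure_function_pushforward__canonical__measure_function_Measure P
  (@measurable_cons_rV n).
have S : sigma_finite setT M.
  have /sigma_finiteP[F [TF ndF Foo]] := sigma_finiteT l.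
  have /sigma_finiteP[G [TG ndG Goo]] := sigma_finiteT m.
  exists (fun k => @uncons_rV n @^-1` (F k `*` G k)).
    rewrite -preimage_bigcup; apply/seteqP; split => // x _.
    have [i _ Fi] : (\bigcup_k F k) (uncons_rV x).1 by rewrite -TF.
    have [j _ Gj] : (\bigcup_k G k) (uncons_rV x).2 by rewrite -TG.
    exists (maxn i j) => //; split.
    - by move: Fi; exact/subsetPset/ndF/leq_maxl.
    - by move: Gj; exact/subsetPset/ndG/leq_maxr.
  move=> k; have [mF Fk] := Foo k; have [mG Gk] := Goo k; split.
    by rewrite -[X in measurable X]setTI; apply: measurable_uncons_rV => //;
      exact: measurableX.
  rewrite /M/= /pushforward -comp_preimage (_ : _ \o _ = idfun).
    by rewrite preimage_id product_measure1E// lte_mul_pinfty// ge0_fin_numE.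
  by apply/funext => p; exact: cons_rVK.
pose H1 := isSigmaFinite.Build _ _ _ _ S.
pose H2 := isSFinite.Build _ _ _ _ (sfinite_measure_sigma_finite S).
by exists (HB.pack_for (sigma_finite_measure 'rV[R]_n.+1 R) (Measure.sort M) H1 H2).
Qed.

Let lebesgue_rV0 n : lebesgue_rV n set0 = 0.
Proof. by have [m ->] := lebesgue_rV_sigma_finite_measure n. Qed.

Let lebesgue_rV_ge0 n A : 0 <= lebesgue_rV n A.
Proof. by have [m ->] := lebesgue_rV_sigma_finite_measure n. Qed.

Let lebesgue_rV_sigma_additive n : semi_sigma_additive (lebesgue_rV n).
Proof.
have [m ->] := lebesgue_rV_sigma_finite_measure n.
exact: measure_semi_sigma_additive.
Qed.

HB.instance Definition _ n := isMeasure.Build _ _ _ (lebesgue_rV n)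
  (lebesgue_rV0 n) (@lebesgue_rV_ge0 n) (@lebesgue_rV_sigma_additive n).

Let lebesgue_rV_sigma_finite n : sigma_finite setT (lebesgue_rV n).
Proof.
have [m ->] := lebesgue_rV_sigma_finite_measure n; exact: sigma_finiteT.
Qed.

HB.instance Definition _ n := Measure_isSigmaFinite.Build _ _ _ (lebesgue_rV n)
  (lebesgue_rV_sigma_finite n).

Lemma lebesgue_rV_box n (a b : 'rV[R]_n) :
  (forall i, (a ord0 i <= b ord0 i)%R) ->
  lebesgue_rV n [set x : 'rV[R]_n | forall i, x ord0 i \in `[a ord0 i, b ord0 i]] =
  (\prod_(i < n) (b ord0 i - a ord0 i))%:E.
Proof.
elim: n => [|n IH] in a b *.
  move=> _; rewrite big_ord0 /= diracE mem_set//= => -[].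
  by [].
move=> ab; rewrite big_ord_recl.
pose tl (x : 'rV[R]_n.+1) : 'rV[R]_n := (uncons_rV x).2.
have tlE x i : tl x ord0 i = x ord0 (lift ord0 i).
  by rewrite /tl mxE; congr (fun_of_matrix _ _ _); exact: val_inj.
have cons0 (p : measurableTypeR R * 'rV[R]_n) : cons_rV p ord0 ord0 = p.1 :> R.
  by rewrite -[in RHS](cons_rVK p).
have consl (p : measurableTypeR R * 'rV[R]_n) i : cons_rV p ord0 (lift ord0 i) = p.2 ord0 i :> R.
  by rewrite -tlE /tl cons_rVK.
transitivity ((lebesgue_measure \x lebesgue_rV n) (`[a ord0 ord0, b ord0 ord0] `*`
    [set x : 'rV[R]_n | forall i, x ord0 i \in `[tl a ord0 i, tl b ord0 i]])).
  congr (product_measure1 _ _ _); apply/seteqP; split=> p /=.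
    move=> H; split => [|i]; first by have := H ord0; rewrite cons0.
    by have := H (lift ord0 i); rewrite consl !tlE.
  move=> [H0 H] i; case: (unliftP ord0 i) => [j|] ->; last by rewrite cons0.
  by have := H j; rewrite consl !tlE.
rewrite product_measure1E//; last first.
  rewrite (_ : [set x | _] = \bigcap_(i in [set: 'I_n])
    ((fun x : 'rV[R]_n => x ord0 i) @^-1` `[tl a ord0 i, tl b ord0 i])); last first.
    by apply/seteqP; split => [x H i _|x H i]; [exact: H|exact: (H i Logic.I)].
  apply: fin_bigcap_measurable => // i _.
  by rewrite -[X in measurable X]setTI; exact: measurable_rV_coord.
have IHt := IH (tl a) (tl b); rewrite [X in _ * X]IHt; last first.
  by move=> i; rewrite !tlE.
rewrite EFinM; congr (_ * _); last first.
  by congr EFin; apply: eq_bigr => i _; rewrite !tlE.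
rewrite [LHS](@lebesgue_measure_itv R `[a ord0 ord0, b ord0 ord0])/= lte_fin.
have := ab ord0.
by rewrite le_eqVlt => /predU1P[->|->//]; rewrite ltxx subrr.
Qed.

End lebesgue_rV.
Arguments lebesgue_rV {R} n _.

Section calculus.
Context {R : realType} {n : nat}.
Implicit Types (f : 'rV[R]_n -> R) (x u : 'rV[R]_n) (A : 'M[R]_n).

Definition partial f (i : 'I_n) : 'rV[R]_n -> R :=
  fun x => 'D_(delta_mx ord0 i) f x.

Definition grad f x : 'rV[R]_n := \row_i partial f i x.

Definition hessian f x : 'M[R]_n :=
  \matrix_(i, j) partial (partial f j) i x.

(* f is k times continuously differentiable on the open set U: all its partial
   derivatives up to order k exist and are continuous at the points of U *)
Fixpoint Ck (k : nat) (U : set 'rV[R]_n) f : Prop :=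
  (forall x, U x -> {for x, continuous f}) /\
  match k with
  | 0 => True
  | k'.+1 => forall i, (forall x, U x -> derivable f x (delta_mx ord0 i)) /\
                       Ck k' U (partial f i)
  end.

Definition even_fun f := forall x, f (- x) = f x.

Definition homogeneous2 f := forall (t : R) x, 0 < t -> f (t *: x) = t ^+ 2 * f x.

(* <A u, u> *)
Definition quadform A u : R := (u *m A *m u^T) ord0 ord0.

Definition posdef A := A^T = A /\ forall u, u != 0 -> 0 < quadform A u.

End calculus.

Section gibbs.
Context {R : realType} {n : nat}.
Implicit Types (Phi : 'rV[R]_n -> R) (mu : probability 'rV[R]_n R).
Local Open Scope ereal_scope.

(* mu = e^{-Phi} dx / Z with Z = \int e^{-Phi} dx. If Z were 0 or +oo the
   right-hand side would vanish identically, so that, mu being a probability,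
   0 < Z < +oo is part of the condition. *)
Definition is_gibbs Phi mu :=
  forall A, measurable A ->
    mu A = (fine (\int[lebesgue_rV n]_x (expR (- Phi x))%:E))^-1%:E *
           \int[lebesgue_rV n]_(x in A) (expR (- Phi x))%:E.

(* D^2 Phi need not exist at the origin, a mu-null set when n > 0. *)
Definition strong_brascamp_lieb Phi mu :=
  forall f : 'rV[R]_n -> R,
    Ck 1 setT f -> f \in Lfun mu 2%:E -> even_fun f ->
    'V_mu[f] <= (2^-1)%:E *
      \int[mu]_x (quadform (invmx (hessian Phi x)) (grad f x))%:E.

Definition gaussian mu :=
  exists (m : 'rV[R]_n) (A : 'M[R]_n),
    posdef A /\ is_gibbs (fun x => quadform A (x - m)) mu.

Definition posdef_quadratic_form Phi :=
  exists A : 'M[R]_n, posdef A /\ forall x, Phi x = quadform A x.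

End gibbs.

(* Main.v *)
Require Import Defs.
From HB Require Import structures.
From mathcomp Require Import all_boot all_order all_algebra.
From mathcomp Require Import all_classical all_reals all_analysis.
From mathcomp Require Import ring lra measurable_realfun.
From mathcomp Require unstable.

(** Write p for the gradient and H for the Hessian of Phi, and M for the matrix
    of means of p_i p_j under mu. Euler's identities for the 2-homogeneous Phi
    read H x = p and <p, x> = 2 Phi, and H is symmetric positive definite away
    from the origin: symmetric by the equality of mixed derivatives, positive
    semidefinite by convexity, definite because its determinant does not vanish.

    The even test functions are the products y_i y_j, where the y_i are the
    derivatives of Phi along a basis orthonormal for M, so that y_i y_j has mean
    delta_ij. For Phi = |x|^2 / 2 they are the quadratic monomials, for which the
    inequality is an equality. Let H' be the matrix of H in that basis. The
    gradient of y_i y_j is H applied to the vector y_i a_j + y_j a_i, where the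
    a_i are the basis vectors, so the inverse Hessian cancels in the energy, and
    the sum over i and j of the inequalities reads

      E |y|^4 - n <= E (|y|^2 tr H' + <H' y, y>).

    Integrating the quartic means by parts against exp(-Phi) gives

      E |y|^4 = E (|y|^2 tr H' + 2 <H' y, y>),

    hence E <H' y, y> <= n. Let z = sum_i y_i a_i be the dual vector of p for the
    metric M. Then <H' y, y> = <H z, z> and Euler's identities give

      <H (z - x), z - x> = <H' y, y> - 2 |y|^2 + 2 Phi,

    whose mean is at most n - 2 n + n = 0 (the mean of 2 Phi = <p, x> is n, again
    by parts). The left-hand side is nonnegative and continuous off the origin,
    and mu charges every nonempty open set, so it vanishes there and z = x. This
    means p = M x: the gradient of Phi is linear and Phi is the quadratic form
    M / 2.

    The analytic lemmas behind this are few. [gibbs_integration_by_parts] follows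
    from [integral_derive0]: if a function and its derivative decay
    exponentially, then the derivative has integral zero, because Lebesgue measure
    is translation invariant ([lebesgue_rV_shift]). [tame_weight_bound] provides the decay, Phi being at
    least a positive multiple of |x|^2. [second_difference] yields both the
    symmetry ([derive_comm]) and the positivity ([convex_derive2_ge0]) of the
    Hessian. At the origin the Hessian may be discontinuous, but its entries exist
    there ([is_derive_partial_axis]) and are bounded ([hessian_bound]), which
    makes the products y_i y_j continuously differentiable everywhere
    ([frame_product_C1]). *)

Set Implicit Arguments.
Unset Strict Implicit.

Import Order.TTheory GRing.Theory Num.Theory.
Import numFieldNormedType.Exports.

Local Open Scope classical_set_scope.
Local Open Scope ring_scope.

(** * Directional derivatives *)

Lemma is_derive_line (R : realType) (V : normedModType R) (f : V -> R) (x v : V)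
    (t : R) : derivable f (x + t *: v) v ->
  is_derive t (1 : R) (fun s : R => f (x + s *: v)) ('D_v f (x + t *: v)).
Proof.
have E : (fun h : R => h^-1 *: ((f \o shift (x + t *: v)) (h *: v) - f (x + t *: v)))
   = (fun h => h^-1 *: (((fun s : R => f (x + s *: v)) \o shift t) (h *: (1 : R))
        - f (x + t *: v))).
  apply/funext => h /=; congr (_ *: (f _ - _)).
  by rewrite [h *: 1]mulr1 scalerDl addrCA.
by move=> df; split; [move: df; rewrite /derivable E|rewrite /derive E].
Qed.

Lemma MVT_line_pos (R : realType) (V : normedModType R) (f : V -> R) (x v : V)
    (t : R) : 0 < t ->
  (forall s, 0 <= s <= t -> derivable f (x + s *: v) v) ->
  exists2 s, 0 <= s <= t & f (x + t *: v) - f x = t * 'D_v f (x + s *: v).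
Proof.
move=> t0 df.
have dg s : 0 <= s <= t -> is_derive s (1 : R) (fun s : R => f (x + s *: v))
    ('D_v f (x + s *: v)) by move=> /df; exact: is_derive_line.
have [||s] := @MVT R (fun s : R => f (x + s *: v)) (fun s => 'D_v f (x + s *: v)) 0 t t0.
- by move=> s; rewrite in_itv /= => /andP[s0 st]; apply: dg; rewrite !ltW.
- apply: derivable_within_continuous => s; rewrite in_itv /= => st.
  by have [] := dg _ st.
rewrite in_itv /= => /andP[s0 st]; rewrite scale0r addr0 subr0 mulrC => E.
by exists s => //; rewrite !ltW.
Qed.

(** A negative step is a positive one from the other end of the segment. *)
Lemma MVT_line (R : realType) (V : normedModType R) (f : V -> R) (x v : V)
    (t : R) :
  (forall s, `|s| <= `|t| -> derivable f (x + s *: v) v) ->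
  exists2 s, `|s| <= `|t| & f (x + t *: v) - f x = t * 'D_v f (x + s *: v).
Proof.
move=> df; have [t0|t0|->] := ltgtP t 0; last first.
- by exists 0; rewrite ?normr0// !scale0r addr0 subrr mul0r.
- have [s /andP[s0 st] E] : exists2 s, 0 <= s <= t &
    f (x + t *: v) - f x = t * 'D_v f (x + s *: v).
    apply: MVT_line_pos => // s /andP[s0 st].
    by apply: df; rewrite ger0_norm// gtr0_norm.
  by exists s => //; rewrite ger0_norm// gtr0_norm.
- have E0 s : x + t *: v + s *: v = x + (t + s) *: v by rewrite -addrA -scalerDl.
  have nt : 0 < - t by rewrite oppr_gt0.
  have [|s /andP[s0 st]] := @MVT_line_pos R V f (x + t *: v) v (- t) nt.
  + move=> s /andP[s0 st]; rewrite E0; apply: df.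
    by rewrite [`|t|]ler0_norm ?(ltW t0)// ler_norml; apply/andP; split; lra.
  + rewrite !E0 subrr scale0r addr0 => E; exists (t + s).
      by rewrite [`|t|]ler0_norm ?(ltW t0)// ler_norml; apply/andP; split; lra.
    by rewrite -[LHS]opprB E mulNr opprK.
Qed.

Lemma is_derive_from_line (R : realType) (V : normedModType R) (f : V -> R) (x v : V)
    (d : R) : is_derive (0 : R) (1 : R) (fun s : R => f (x + s *: v)) d ->
  is_derive x v f d.
Proof.
have E : (fun h : R => h^-1 *: ((f \o shift x) (h *: v) - f x)) =
    (fun h : R => h^-1 *: (((fun s => f (x + s *: v)) \o shift 0) (h *: (1 : R)) -
       f (x + 0 *: v))).
  apply/funext => h /=; congr (_ *: (f _ - f _)); last by rewrite scale0r addr0.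
  by rewrite addr0 [h *: 1]mulr1 addrC.
case=> D1 D2; split; [rewrite /derivable E; exact: D1|rewrite /derive E; exact: D2].
Qed.

Lemma is_derive_scale_dir (R : realType) (V : normedModType R) (f : V -> R)
    (x v : V) (c : R) : derivable f x v ->
  is_derive x (c *: v) f (c * 'D_v f x).
Proof.
move=> df; have := @is_derive_line R V f x v 0.
rewrite scale0r addr0 => /(_ df) dg.
have {}dg : is_derive (c * 0) (1 : R) (fun s : R => f (x + s *: v)) ('D_v f x).
  by rewrite mulr0.
have dm : is_derive (0 : R) (1 : R) (c \*: (@id R)) c.
  by apply: is_derive_eq; rewrite [LHS]mulr1.
have dc := @is_derive1_comp R _ _ (0 : R) _ _ dg dm.
apply: is_derive_from_line; rewrite mulrC.
rewrite (_ : (fun s : R => _) = (fun s : R => f (x + s *: v)) \o (c \*: @id R)).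
  exact: dc.
by apply/funext => s /=; rewrite scalerA [s * c]mulrC.
Qed.

(** The chain rule for an outer function of one variable, read along a line. *)
Lemma is_derive_comp_scalar (R : realType) (V : normedModType R) (h : R -> R)
    (f : V -> R) (x v : V) (dh df : R) :
  is_derive (f x) (1 : R) h dh -> is_derive x v f df ->
  is_derive x v (h \o f) (dh * df).
Proof.
move=> Dh [df1 df2]; apply: is_derive_from_line.
have := @is_derive_line R V f x v 0; rewrite scale0r addr0 df2 => /(_ df1) dl.
apply: (@is_derive1_comp R h (fun s : R => f (x + s *: v)) 0 _ _ _ dl).
by rewrite scale0r addr0.
Qed.

(** The increment along w + u is an increment along w followed by one along u;
    the mean value theorem turns the second into a derivative along u at a point
    close to x. *)
Lemma is_derive_add_dir (R : realType) (V : normedModType R) (f : V -> R)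
    (x w u : V) : derivable f x w ->
  (\forall y \near x, derivable f y u) -> {for x, continuous ('D_u f)} ->
  is_derive x (w + u) f ('D_w f x + 'D_u f x).
Proof.
move=> dw du cu.
suff H : h^-1 *: ((f \o shift x) (h *: (w + u)) - f x) @[h --> 0^'] -->
    'D_w f x + 'D_u f x.
  by split; [apply/cvg_ex; eexists; exact: H | exact: cvg_lim H].
pose P h := h^-1 * (f (h *: (w + u) + x) - f (h *: w + x)).
have -> : (fun h : R => h^-1 *: ((f \o shift x) (h *: (w + u)) - f x)) =
    (fun h => h^-1 *: ((f \o shift x) (h *: w) - f x) + P h).
  by apply/funext => h; rewrite /P/= -mulrDr; congr (_ * _); rewrite [RHS]addrC addrA subrK.
apply: cvgD; first exact: dw.
apply/cvgrPdist_le => /= e e0.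
have /cvgrPdist_le/(_ e e0) := cu.
move=> /(fun h => filterI h du) /nbhs_normP[d /= d0 Hd].
have C0 : 0 < `|w| + `|u| + 1 by rewrite ltr_wpDl// addr_ge0.
near=> h.
have hn0 : h != 0 by near: h; exact: nbhs_dnbhs_neq.
have hd : `|h| < d / (`|w| + `|u| + 1).
  near: h; apply: dnbhs0_lt; exact: divr_gt0.
have B s : `|s| <= `|h| -> ball_ Num.norm x d (h *: w + x + s *: u).
  move=> sh; have -> : h *: w + x + s *: u = x + (h *: w + s *: u).
    by rewrite [h *: w + x]addrC addrA.
  rewrite /ball_ /= opprD addrA subrr sub0r normrN.
  move: hd; rewrite ltr_pdivlMr//; apply: le_lt_trans.
  apply: (le_trans (ler_normD _ _)); rewrite !normrZ !mulrDr mulr1.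
  rewrite -[leLHS]addr0; apply: lerD => //; apply: lerD => //.
  exact: ler_wpM2r.
have [|s sh E] := @MVT_line R V f (h *: w + x) u h.
  by move=> s sh; have [] := Hd _ (B _ sh).
have [+ _] := Hd _ (B _ sh).
suff -> : P h = 'D_u f (h *: w + x + s *: u) by [].
rewrite /P scalerDr addrAC E mulrA mulVf// mul1r.
by [].
Unshelve. all: by end_near. Qed.

Lemma is_derive_shift_dir (R : realType) (V : normedModType R) (f : V -> R)
    (w x v : V) (df : R) :
  is_derive (x + w) v f df -> is_derive x v (fun y => f (y + w)) df.
Proof.
have E : (fun h : R => h^-1 *: ((f \o shift (x + w)) (h *: v) - f (x + w))) =
    (fun h => h^-1 *: (((fun y => f (y + w)) \o shift x) (h *: v) - f (x + w))).
  by apply/funext => h /=; rewrite addrA.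
case; rewrite /derivable /derive E => D1 D2; exact: DeriveDef D1 D2.
Qed.

Lemma subr_swap (R : zmodType) (a b c d : R) : a - b - (c - d) = a - c - (b - d).
Proof. by rewrite !opprB addrACA [RHS]addrACA [- c - b]addrC. Qed.

(** The mean value theorem, along v for the increment along u and then along u.
    The symmetry of second derivatives and the positivity of the Hessian of a
    convex function both come from this formula. *)
Lemma second_difference (R : realType) (V : normedModType R) (f : V -> R)
    (x u v : V) (h : R) : 0 < h ->
  (forall s t, 0 <= s <= h -> 0 <= t <= h ->
    derivable f (x + s *: u + t *: v) v /\
    derivable ('D_v f) (x + s *: u + t *: v) u) ->
  exists s t, [/\ 0 <= s <= h, 0 <= t <= h &
    f (x + h *: u + h *: v) - f (x + h *: v) - (f (x + h *: u) - f x) =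
    h ^+ 2 * 'D_u ('D_v f) (x + s *: u + t *: v)].
Proof.
move=> h0 df; have hh : 0 <= h <= h by rewrite ltW/=.
have h00 : 0 <= (0 : R) <= h by rewrite lexx ltW.
pose g y := f (y + h *: u) - f y.
have gE y : g = (fun y => f (y + h *: u)) - f by [].
have sh (t : R) : x + t *: v + h *: u = x + h *: u + t *: v by rewrite addrAC.
have dgt t : 0 <= t <= h -> is_derive (x + t *: v) v g
    ('D_v f (x + h *: u + t *: v) - 'D_v f (x + t *: v)).
  move=> th; apply: is_deriveB; last first.
    by have [+ _] := df _ _ h00 th; rewrite scale0r addr0 => /derivableP.
  have [+ _] := df _ _ hh th => D.
  by apply: is_derive_shift_dir; rewrite sh; exact/derivableP.
have [|t th E] := @MVT_line_pos R V g x v h h0.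
  by move=> t /dgt[].
have [|s sh' E'] := @MVT_line_pos R V ('D_v f) (x + t *: v) u h h0.
  by move=> s /df /(_ th)[_]; rewrite addrAC.
exists s, t; split; [exact: sh'|exact: th|move: E; rewrite /g].
have [_ ->] := dgt _ th.
rewrite -(sh t) E' mulrA -expr2 [x + t *: v + s *: u]addrAC => <-.
by rewrite sh subr_swap.
Qed.

Lemma near_box (R : realType) (V : normedModType R) (x u v : V) (U : set V) :
  nbhs x U -> exists2 d : R, 0 < d & forall s t, `|s| <= d -> `|t| <= d ->
    U (x + s *: u + t *: v).
Proof.
move=> /nbhs_normP[e /= e0 He].
have C0 : 0 < `|u| + `|v| + 1 by rewrite ltr_wpDl// addr_ge0.
exists (e / (`|u| + `|v| + 1)); first exact: divr_gt0.
move=> s t sd td; apply: He; rewrite /ball_ /= -addrA opprD addrA subrr sub0r normrN.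
apply: (le_lt_trans (ler_normD _ _)); rewrite !normrZ.
rewrite (@le_lt_trans _ _ ((e / (`|u| + `|v| + 1)) * (`|u| + `|v|)))//.
  by rewrite mulrDr; apply: lerD; exact: ler_wpM2r.
by rewrite mulrAC ltr_pdivrMr// ltr_pM2l// ltrDl.
Qed.

Lemma halves_dist (R : realType) (a b c d e : R) :
  a = b -> `|c - a| <= e / 2 -> `|d - b| <= e / 2 -> `|c - d| <= e.
Proof.
move=> -> ca db; apply: (le_trans (ler_distD b _ _)).
by rewrite [leRHS]splitr lerD// distrC.
Qed.

(** Both mixed derivatives, at points close to x, are quotients of the same
    second difference. *)
Lemma derive_comm (R : realType) (V : normedModType R) (f : V -> R) (x u v : V) :
  (\forall y \near x, derivable f y v /\ derivable ('D_v f) y u) ->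
  (\forall y \near x, derivable f y u /\ derivable ('D_u f) y v) ->
  {for x, continuous ('D_u ('D_v f))} -> {for x, continuous ('D_v ('D_u f))} ->
  'D_u ('D_v f) x = 'D_v ('D_u f) x.
Proof.
move=> d1 d2 c1 c2; apply/eqP; rewrite -subr_eq0 -normr_le0.
apply/ler_addgt0Pl => e e0; rewrite addr0.
have e20 : 0 < e / 2 by rewrite divr_gt0.
have /cvgrPdist_le/(_ _ e20) n1 := c1.
have /cvgrPdist_le/(_ _ e20) n2 := c2.
have [a a0 Ha] := @near_box R V x u v _ (filterI d1 n1).
have [b b0 Hb] := @near_box R V x v u _ (filterI d2 n2).
pose h := Num.min a b.
have h0 : 0 < h by rewrite lt_min a0.
have nh s : 0 <= s <= h -> `|s| <= a /\ `|s| <= b.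
  by move=> /andP[s0]; rewrite le_min => /andP[sa sb]; rewrite !ger0_norm.
have [s [t [sh th E]]] := @second_difference R V f x u v h h0
  (fun s t sh th => proj1 (Ha s t (proj1 (nh s sh)) (proj1 (nh t th)))).
have [s' [t' [sh' th' E']]] := @second_difference R V f x v u h h0
  (fun s t sh th => proj1 (Hb s t (proj2 (nh s sh)) (proj2 (nh t th)))).
have [_ B1] := Ha s t (proj1 (nh s sh)) (proj1 (nh t th)).
have [_ B2] := Hb s' t' (proj2 (nh s' sh')) (proj2 (nh t' th')).
have EE : 'D_u ('D_v f) (x + s *: u + t *: v) = 'D_v ('D_u f) (x + s' *: v + t' *: u).
  have h20 : h ^+ 2 != 0 by rewrite sqrf_eq0 gt_eqF.
  have Ec : x + h *: u + h *: v = x + h *: v + h *: u by rewrite addrAC.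
  apply: (mulfI h20); apply: (etrans (esym E)); apply: (etrans _ E').
  by rewrite Ec; exact: (@subr_swap R (f (x + h *: v + h *: u))). 
exact: halves_dist EE B1 B2.
Qed.

(** * Partial derivatives and convexity *)

(** The direction v is reached by adding its coordinates one at a time. *)
Lemma is_derive_partials (R : realType) (n : nat) (f : 'rV[R]_n -> R) (x v : 'rV[R]_n) :
  (forall i, \forall y \near x, derivable f y (delta_mx ord0 i)) ->
  (forall i, {for x, continuous (partial f i)}) ->
  is_derive x v f (\sum_i v ord0 i * partial f i x).
Proof.
move=> df cf; rewrite [v in is_derive _ v]row_sum_delta.
elim: (index_enum _) => [|i s IH]; first by rewrite !big_nil; exact: is_derive0.
rewrite !big_cons [_ *: _ + _]addrC [_ * _ + _]addrC.
have dZ y : derivable f y (delta_mx ord0 i) ->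
    is_derive y (v ord0 i *: delta_mx ord0 i) f (v ord0 i * partial f i y).
  exact: is_derive_scale_dir.
have dx := nbhs_singleton (df i).
have [D1 D2] := IH.
have [_ E] := dZ x dx.
have N : \forall y \near x, derivable f y (v ord0 i *: delta_mx ord0 i).
  by apply: filterS (df i) => y /dZ[].
have C : {for x, continuous ('D_(v ord0 i *: delta_mx ord0 i) f)}.
  rewrite /prop_for /continuous_at E.
  apply: (@cvg_trans _ ((fun y => v ord0 i * partial f i y) @ x)).
    have H : \forall y \near x, v ord0 i * partial f i y =
        'D_(v ord0 i *: delta_mx ord0 i) f y.
      by apply: filterS (df i) => y /dZ[_ ->].
    exact: near_eq_cvg H.
  exact: (cvgM (cvg_cst _) (cf i)).
have [A1 A2] := is_derive_add_dir D1 N C.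
by split; [exact: A1|apply: (etrans A2); congr (_ + _); [exact: D2|exact: E]].
Qed.

Lemma convex_midpoint (R : realType) (V : normedModType R) (f : V -> R) (x y : V) :
  @convex_function R V setT f -> 2 * f (2^-1 *: (x + y)) <= f x + f y.
Proof.
have h0 : 0 <= (2^-1 : R) by rewrite invr_ge0.
have h1 : (2^-1 : R) <= 1 by lra.
move=> /(_ (@Itv01 R 2^-1 h0 h1) x y (in_setT _) (in_setT _)) /=.
rewrite convRE/= => H; have E : 1 - 2^-1 = 2^-1 :> R by lra.
move: H; rewrite /conv /= /unstable.onem E => H.
have : f (2^-1 *: (x + y)) <= 2^-1 * (f x + f y).
  by rewrite scalerDr mulrDr; exact: H.
by move: (f _) => a; lra.
Qed.

Lemma second_difference_ge0 (R : realFieldType) (a b c : R) :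
  2 * a <= b + c -> 0 <= b - a - (a - c).
Proof. by move=> ?; lra. Qed.

(** Midpoint convexity makes the symmetric second differences nonnegative, and
    these are second derivatives at points close to x. *)
Lemma convex_derive2_ge0 (R : realType) (V : normedModType R) (f : V -> R) (x u : V) :
  @convex_function R V setT f ->
  (\forall y \near x, derivable f y u /\ derivable ('D_u f) y u) ->
  {for x, continuous ('D_u ('D_u f))} -> 0 <= 'D_u ('D_u f) x.
Proof.
move=> cf df c2; have half : 2^-1 + 2^-1 = 1 :> R by lra.
rewrite leNgt; apply/negP => D0.
have neg : \forall y \near x, 'D_u ('D_u f) y < 0.
  exact: (cvgr_lt _ c2 _ D0).
have [h h0 H] := @near_box R V x u u _ (filterI df neg).
have hs s : 0 <= s <= h -> `|s - h| <= h /\ `|s| <= h.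
  move=> /andP[s0 sh]; rewrite (ger0_norm s0); split=> //.
  by rewrite ler0_norm ?subr_le0// opprB gerBl.
have E s t : x - h *: u + s *: u + t *: u = x + (s - h) *: u + t *: u.
  by rewrite scalerBl [x - _ + _]addrAC [x + (_ - _)]addrA.
have dom s t : 0 <= s <= h -> 0 <= t <= h ->
    derivable f (x - h *: u + s *: u + t *: u) u /\
    derivable ('D_u f) (x - h *: u + s *: u + t *: u) u.
  by move=> /hs[sh _] /hs[_ th]; rewrite E; have [] := H _ _ sh th.
have [s [t [sh th D]]] := second_difference h0 dom.
have [_ /=] := H _ _ (proj1 (hs s sh)) (proj2 (hs t th)); rewrite -E => N.
have : h ^+ 2 * 'D_u ('D_u f) (x - h *: u + s *: u + t *: u) < 0.
  by rewrite pmulr_rlt0// exprn_gt0.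
rewrite -D; apply/negP; rewrite -leNgt.
have := @convex_midpoint R V f (x - h *: u + h *: u + h *: u) (x - h *: u) cf.
set a := x - h *: u + h *: u.
have -> : 2^-1 *: (a + h *: u + (x - h *: u)) = a.
  rewrite /a subrK addrACA subrr addr0 scalerDr.
  by rewrite -scalerDl half scale1r.
exact: second_difference_ge0.
Qed.

(** * Homogeneous functions *)

Definition homogeneous_of {R : realType} {V : lmodType R} (d : nat) (f : V -> R) :=
  forall (t : R) x, 0 < t -> f (t *: x) = t ^+ d * f x.

Lemma is_derive_homogeneous (R : realType) (V : normedModType R) (d : nat)
    (f : V -> R) (x v : V) (t : R) : homogeneous_of d.+1 f -> 0 < t ->
  derivable f x v -> is_derive (t *: x) v f (t ^+ d * 'D_v f x).
Proof.
move=> hf t0 df; have tn0 : t != 0 by rewrite gt_eqF.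
have := is_deriveZ (t ^+ d.+1) (@is_derive_scale_dir R V f x v t^-1 df).
have -> : t ^+ d.+1 *: (t^-1 * 'D_v f x) = t ^+ d * 'D_v f x.
  by rewrite [LHS]mulrA exprSr mulfK.
rewrite exprSr.
have E : (fun h : R => h^-1 *: ((f \o shift (t *: x)) (h *: v) - f (t *: x))) =
    (fun h : R => h^-1 *: (((t ^+ d * t \*: f) \o shift x) (h *: (t^-1 *: v)) -
       (t ^+ d * t \*: f) x)).
  apply/funext => h /=; rewrite -exprSr hf//; congr (_ * (_ - _)).
  by rewrite -[LHS]/(f _) -[RHS]/(_ * f _) -hf// scalerDr !scalerA mulrAC mulfV ?mul1r.
case=> D1 D2; split; [rewrite /derivable E; exact: D1|rewrite /derive E; exact: D2].
Qed.

Lemma partial_homogeneous (R : realType) (n d : nat) (f : 'rV[R]_n -> R) i :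
  homogeneous_of d.+1 f ->
  (forall x, x != 0 -> derivable f x (delta_mx ord0 i)) ->
  forall (t : R) x, 0 < t -> x != 0 -> partial f i (t *: x) = t ^+ d * partial f i x.
Proof.
by move=> hf df t x t0 x0; have [_] := is_derive_homogeneous hf t0 (df x x0).
Qed.

(** Euler's identity: near x, the function is f x * (1 + s) ^+ d along the ray
    x + s x. *)
Lemma euler_homogeneous (R : realType) (V : normedModType R) (d : nat)
    (f : V -> R) (x : V) : homogeneous_of d f -> is_derive x x f (d%:R * f x).
Proof.
move=> hf.
have D1 : is_derive (0 : R) (1 : R) (cst 1 + @id R) 1.
  by apply: is_derive_eq; rewrite add0r.
have D2 : is_derive (0 : R) (1 : R) (f x \*: (cst 1 + @id R) ^+ d) (d%:R * f x).
  have D := is_deriveX d D1.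
  apply: is_derive_eq; rewrite (_ : (cst 1 + @id R) 0 = 1); last exact: addr0.
  by rewrite expr1n mulr1 [_ *: 1]mulr1 mulrC.
have N : \forall s \near (0 : R), (f x \*: (cst 1 + @id R) ^+ d) s = f (x + s *: x).
  apply: filterS (nbhsx_ballx (0 : R) 1 ltr01) => s; rewrite /ball/= sub0r normrN.
  rewrite ltr_norml => /andP[]; rewrite -subr_gt0 opprK addrC => s1 _.
  have -> : x + s *: x = (1 + s) *: x by rewrite scalerDl scale1r.
  rewrite hf// mulrC.
  by rewrite exprfctE.
exact: is_derive_from_line (near_eq_is_derive N D2).
Qed.

Lemma sphere_compact (R : realType) (n : nat) : compact [set x : 'rV[R]_n | `|x| = 1].
Proof.
apply: bounded_closed_compact.
  by exists 1; split => // r r1 x /= ->; exact: ltW.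
have -> : [set x : 'rV[R]_n | `|x| = 1] = (fun x : 'rV[R]_n => `|x|) @^-1` [set 1] by [].
apply: closed_comp; last exact: closed_eq.
by move=> x _; exact: norm_continuous.
Qed.

(** A continuous function on the sphere is bounded, and homogeneity carries the
    bound to the whole space. *)
Lemma homogeneous_bound (R : realType) (n d : nat) (g : 'rV[R]_n -> R) :
  (forall x, x != 0 -> {for x, continuous g}) ->
  (forall (t : R) x, 0 < t -> x != 0 -> g (t *: x) = t ^+ d * g x) ->
  exists2 K : R, 0 <= K & forall x, x != 0 -> `|g x| <= K * `|x| ^+ d.
Proof.
move=> cg hg; set S := [set x : 'rV[R]_n | `|x| = 1].
have cS : {within S, continuous (fun x => `|g x|)}.
  apply/continuous_in_subspaceT => x; rewrite inE => Sx.
  apply: continuous_comp; last exact: norm_continuous.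
  by apply: cg; rewrite -normr_eq0 Sx oner_eq0.
have nS (x : 'rV[R]_n) : x != 0 -> S (`|x|^-1 *: x).
  move=> x0; rewrite /S /= normrZ ger0_norm ?invr_ge0// mulVf//.
  by rewrite normr_eq0.
have [[x0 Sx0]|S0] := pselect (S !=set0); last first.
  by exists 0 => // x /nS Sx; case: S0; eexists; exact: Sx.
have [c cS' Hc] := compact_EVT_max (ex_intro _ x0 Sx0) (@sphere_compact R n) cS.
exists `|g c| => // x xn0; have x0' : 0 < `|x| by rewrite normr_gt0.
have -> : g x = `|x| ^+ d * g (`|x|^-1 *: x).
  rewrite -hg//; first by rewrite scalerA mulfV ?scale1r// gt_eqF.
  by rewrite scaler_eq0 negb_or xn0 invr_eq0 gt_eqF.
rewrite normrM [X in X * _]ger0_norm ?exprn_ge0// mulrC ler_wpM2r ?exprn_ge0//.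
by apply: Hc; rewrite inE; exact: nS.
Qed.

(** The quotient |x| ^+ d / g x is homogeneous of degree zero, hence bounded. *)
Lemma homogeneous_lower_bound (R : realType) (n d : nat) (g : 'rV[R]_n -> R) :
  (forall x, x != 0 -> {for x, continuous g}) ->
  (forall (t : R) x, 0 < t -> x != 0 -> g (t *: x) = t ^+ d * g x) ->
  (forall x, x != 0 -> 0 < g x) ->
  exists2 c : R, 0 < c & forall x, x != 0 -> c * `|x| ^+ d <= g x.
Proof.
move=> cg hg g0.
have [||K K0 HK] := @homogeneous_bound R n 0 (fun x => `|x| ^+ d / g x).
- move=> x x0.
  have A : (fun x : 'rV[R]_n => `|x| ^+ d) y @[y --> x] --> `|x| ^+ d.
    exact: (cvg_comp (fun x : 'rV[R]_n => `|x|) (fun t : R => t ^+ d)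
      (@norm_continuous _ _ x) (@exprn_continuous _ _ _)).
  have B : (fun x : 'rV[R]_n => (g x)^-1) y @[y --> x] --> (g x)^-1.
    exact: (cvgV (lt0r_neq0 (g0 x x0)) (cg x x0)).
  exact: (cvgM A B).
- move=> t x t0 x0; rewrite hg// normrZ gtr0_norm// exprMn expr0 mul1r invfM.
  by rewrite mulrACA mulfV ?mul1r// gt_eqF// exprn_gt0.
exists (K + 1)^-1; first by rewrite invr_gt0 ltr_wpDl.
move=> x x0; rewrite ler_pdivrMl ?ltr_wpDl//.
have := HK x x0; rewrite expr0 mulr1 ger0_norm; last first.
  by rewrite divr_ge0 ?exprn_ge0// ltW// g0.
rewrite ler_pdivrMr ?g0// => /le_trans; apply.
by rewrite ler_wpM2r ?lerDl// ltW// g0.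
Qed.

(** * Symmetric forms *)

Lemma quadformE (R : realType) (n : nat) (A : 'M[R]_n) (u : 'rV[R]_n) :
  quadform A u = \sum_i \sum_j u ord0 i * u ord0 j * A i j.
Proof.
rewrite /quadform mxE exchange_big /=; apply: eq_bigr => j _.
rewrite !mxE mulr_suml; apply: eq_bigr => i _; ring.
Qed.

Lemma quadform_sum (R : realType) (n : nat) (A : 'M[R]_n) (u : 'rV[R]_n) :
  quadform A u = \sum_j u ord0 j * \sum_i u ord0 i * A i j.
Proof.
rewrite /quadform mxE; apply: eq_bigr => j _; rewrite !mxE mulrC; congr (_ * _).
Qed.

(** For a symmetric positive semidefinite form, the isotropic vectors make up
    the kernel: perturbing an isotropic vector in any direction would otherwise
    make the form negative. *)
Lemma psd_kernel (R : realType) (n : nat) (A : 'M[R]_n) (u : 'rV[R]_n) :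
  A^T = A -> (forall w, 0 <= quadform A w) -> quadform A u = 0 -> u *m A = 0.
Proof.
move=> sA pA u0; set w := u *m A.
have E t : quadform A (u + t *: w) =
    t * (2 * (w *m w^T) ord0 ord0) + t ^+ 2 * quadform A w.
  have wu : (w *m A *m u^T) ord0 ord0 = (w *m w^T) ord0 ord0.
    rewrite -[in LHS](trmxK (w *m A *m u^T)) mxE !trmx_mul trmxK sA mulmxA.
    by rewrite -/w.
  rewrite /quadform linearD linearZ /= !mulmxDl !mulmxDr -!scalemxAl -!scalemxAr.
  move: u0 wu; rewrite /quadform -/w.
  move: (w *m u^T) (w *m w^T) (w *m A *m u^T) (w *m A *m w^T) => M1 M2 M3 M4 E1 E2.
  by rewrite !mxE E1 E2; ring.
have N0 : 0 <= (w *m w^T) ord0 ord0.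
  by rewrite mxE sumr_ge0// => i _; rewrite [w^T _ _]mxE -expr2 sqr_ge0.
have {E}E t : 0 <= t * (2 * (w *m w^T) ord0 ord0) + t ^+ 2 * quadform A w.
  by rewrite -E.
have Z : (w *m w^T) ord0 ord0 = 0.
  apply/eqP; rewrite eq_le N0 andbT leNgt; apply/negP => Np.
  have := E (- ((w *m w^T) ord0 ord0 / (quadform A w + 1))); apply/negP; rewrite -ltNge.
  move: (pA w) Np; move: ((w *m w^T) _ _) (quadform A w) => a q q0 a0.
  have q1 : 0 < q + 1 by rewrite ltr_wpDl.
  have -> : - (a / (q + 1)) * (2 * a) + (- (a / (q + 1))) ^+ 2 * q =
     - ((a / (q + 1)) ^+ 2 * (q + 2)) by field; rewrite gt_eqF.
  by rewrite oppr_lt0 mulr_gt0// ?exprn_gt0 ?divr_gt0//; lra.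
apply/rowP => i; rewrite [RHS]mxE; move: Z; rewrite mxE => /eqP.
rewrite psumr_eq0; last by move=> j _; rewrite [w^T _ _]mxE -expr2 sqr_ge0.
by move=> /allP/(_ i (mem_index_enum _)) /=; rewrite [w^T _ _]mxE -expr2 sqrf_eq0 => /eqP.
Qed.

Lemma psd_det_posdef (R : realType) (n : nat) (A : 'M[R]_n) :
  A^T = A -> (forall w, 0 <= quadform A w) -> \det A != 0 -> posdef A.
Proof.
move=> sA pA dA; split => // u u0; rewrite lt_neqAle pA andbT eq_sym.
apply: contra u0 => /eqP /(psd_kernel sA pA) uA.
have uA' : A \in unitmx by rewrite unitmxE unitfE.
by rewrite -(mulmxK uA' u) uA mul0mx.
Qed.

Lemma quadform_congr (R : realType) (m n : nat) (A : 'M[R]_n) (L : 'M[R]_(m, n))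
    (u : 'rV[R]_m) : quadform (L *m A *m L^T) u = quadform A (u *m L).
Proof. by rewrite /quadform trmx_mul !mulmxA. Qed.

Lemma symmetric_form_swap (R : realType) (n : nat) (D : 'M[R]_n) (a b : 'rV[R]_n) :
  D^T = D -> (a *m D *m b^T) ord0 ord0 = (b *m D *m a^T) ord0 ord0.
Proof.
move=> sD; rewrite -[in LHS](trmxK (a *m D *m b^T)) [LHS]mxE.
by rewrite !trmx_mul trmxK sD mulmxA.
Qed.

Lemma quadform_sub (R : realType) (n : nat) (D : 'M[R]_n) (a b : 'rV[R]_n) : D^T = D ->
  quadform D (a - b) = quadform D a - 2 * (b *m D *m a^T) ord0 ord0 + quadform D b.
Proof.
move=> sD; have := symmetric_form_swap a b sD.
rewrite /quadform linearB /= !mulmxBl !mulmxBr.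
move: (a *m D *m a^T) (a *m D *m b^T) (b *m D *m a^T) (b *m D *m b^T) => M1 M2 M3 M4 E.
by rewrite !mxE E; ring.
Qed.

Lemma quadform_delta2 (R : realType) (n : nat) (B : 'M[R]_n) (i j : 'I_n) (a b : R) :
  quadform B (a *: delta_mx ord0 j + b *: delta_mx ord0 i) =
  a ^+ 2 * B j j + b ^+ 2 * B i i + a * b * (B i j + B j i).
Proof.
have E k l : (delta_mx 0 k *m B *m (delta_mx 0 l)^T : 'M[R]_1) ord0 ord0 = B k l.
  by rewrite -rowE trmx_delta -colE !mxE.
rewrite /quadform linearD !linearZ /= !mulmxDl !mulmxDr -!scalemxAl -!scalemxAr.
move: (E j j) (E i i) (E i j) (E j i).
move: (_ *m _^T) (_ *m _^T) (_ *m _^T) (_ *m _^T) => M1 M2 M3 M4 E1 E2 E3 E4.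
rewrite !mxE E1 E2 E3 E4; ring.
Qed.

Lemma posdef_congr (R : realType) (m n : nat) (A : 'M[R]_n) (L : 'M[R]_(m, n)) :
  row_free L -> posdef A -> posdef (L *m A *m L^T).
Proof.
move=> fL [sA pA]; split; first by rewrite !trmx_mul trmxK sA mulmxA.
by move=> u u0; rewrite quadform_congr pA// mulmx_free_eq0.
Qed.

(** Every inner product has an orthonormal basis, whose vectors are the rows of
    A: eliminate the first basis vector from the others and recurse on the Schur
    complement. *)
Lemma posdef_whitening (R : realType) (n : nat) (M : 'M[R]_n) : posdef M ->
  exists A : 'M[R]_n, A *m M *m A^T = 1%:M.
Proof.
elim: n M => [|n IH] M pM; first by exists 0; apply/matrixP => -[].
rewrite -[n.+1]/(1 + n)%N in M pM *.
pose c := ulsubmx M 0 0; pose b := ursubmx M; pose d := drsubmx M.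
have ME : M = block_mx c%:M b b^T d.
  have [sM _] := pM; rewrite -[LHS]submxK -mx11_scalar; congr block_mx.
  by rewrite /b trmx_ursub sM.
have quad_l : quadform M (row_mx 1%:M 0) = c.
  rewrite /quadform ME mul_row_block tr_row_mx mul_row_col !mul1mx !mul0mx.
  by rewrite !addr0 trmx1 mulmx1 trmx0 mulmx0 addr0 mxE eqxx mulr1n.
have c0 : 0 < c.
  rewrite -quad_l; apply: pM.2; apply/eqP => /(congr1 lsubmx).
  rewrite row_mxKl => /matrixP/(_ 0 0); rewrite !mxE eqxx => /eqP.
  by rewrite oner_eq0.
pose L : 'M[R]_(1 + n) := block_mx 1%:M 0 (- (c^-1 *: b^T)) 1%:M.
pose S := d - c^-1 *: (b^T *m b).
have LM : L *m M *m L^T = block_mx c%:M 0 0 S.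
  have LT : (- (c^-1 *: b^T))^T = - (c^-1 *: b) by apply/matrixP => i j; rewrite !mxE.
  rewrite ME /L tr_block_mx !trmx1 trmx0 LT !mulmx_block.
  rewrite !mul1mx !mul0mx !mulmx0 !mulmx1 !addr0.
  congr block_mx.
  - by rewrite mulmxN -scalemxAr mul_scalar_mx scalerA mulVf ?scale1r ?addNr// gt_eqF.
  - by rewrite mulNmx -scalemxAl mul_mx_scalar scalerA mulVf ?scale1r ?addNr// gt_eqF.
  - rewrite (_ : - (c^-1 *: b^T) *m c%:M + b^T = 0) ?mul0mx ?add0r; last first.
      by rewrite mulNmx -scalemxAl mul_mx_scalar scalerA mulVf ?scale1r ?addNr// gt_eqF.
    by rewrite mulNmx -scalemxAl addrC.
have Lu : row_free L.
  by rewrite row_free_unit unitmxE /L det_lblock !det1 mulr1 unitr1.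
have pLM := posdef_congr Lu pM; rewrite LM in pLM.
have pS : posdef S.
  have [sLM qLM] := pLM; split.
    by move: sLM; rewrite tr_block_mx => /(congr1 drsubmx); rewrite !block_mxKdr.
  move=> w w0; have := qLM (row_mx 0 w).
  rewrite /quadform mul_row_block tr_row_mx mul_row_col !mul0mx !mulmx0 !add0r trmx0 mulmx0 add0r.
  apply; apply: contra w0 => /eqP /(congr1 rsubmx).
  by rewrite row_mxKr => ->; apply/eqP/rowP => i; rewrite !mxE.
have [A AS] := IH S pS.
exists (block_mx (Num.sqrt c)^-1%:M 0 0 A *m L).
rewrite trmx_mul !mulmxA -(mulmxA _ L) -(mulmxA _ (L *m M)) LM.
rewrite tr_block_mx !trmx0 tr_scalar_mx !mulmx_block !mul0mx !mulmx0 !addr0 !add0r AS.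
rewrite !mul0mx -!scalar_mxM [RHS]scalar_mx_block; congr block_mx.
by rewrite mulrAC -invfM -expr2 sqr_sqrtr ?ltW// mulVf// gt_eqF.
Qed.

(** * The potential *)

Lemma continuous_at_sum (R : realType) (V : normedModType R) (I : Type) (s : seq I)
    (F : I -> V -> R) (x : V) : (forall i, {for x, continuous (F i)}) ->
  {for x, continuous (fun y => \sum_(i <- s) F i y)}.
Proof.
move=> cF; elim: s => [|i s IH].
  rewrite (_ : (fun y => _) = cst 0); first exact: cvg_cst.
  by apply/funext => y; rewrite big_nil.
rewrite (_ : (fun y => _) = (fun y => F i y + \sum_(j <- s) F j y)).
  exact: (cvgD (cF i) IH).
by apply/funext => y; rewrite big_cons.
Qed.

Lemma continuous_at_scale (R : realType) (V : normedModType R) (c : R)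
    (f : V -> R) (x : V) : {for x, continuous f} ->
  {for x, continuous (fun y => c * f y)}.
Proof. by move=> cf; exact: (cvgM (cvg_cst c) cf). Qed.

Lemma is_derive_scalar_sum (R : realType) (V : normedModType R) (I : Type) (s : seq I)
    (F : I -> V -> R) (c dF : I -> R) (x v : V) :
  (forall i, is_derive x v (F i) (dF i)) ->
  is_derive x v (fun y => \sum_(i <- s) c i * F i y) (\sum_(i <- s) c i * dF i).
Proof.
move=> dF'; elim: s => [|i s IH].
  rewrite (_ : (fun y => _) = cst 0); first by rewrite big_nil; exact: is_derive_cst.
  by apply/funext => y; rewrite big_nil.
rewrite (_ : (fun y => _) = (c i \*: F i + (fun y => \sum_(j <- s) c j * F j y))).
  by rewrite big_cons; apply: is_deriveD; apply: is_deriveZ.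
by apply/funext => y; rewrite big_cons.
Qed.


Lemma continuous_at_bound (R : realType) (V : normedModType R) (f : V -> R) (K : R) :
  0 <= K -> f 0 = 0 -> (forall x, `|f x| <= K * `|x|) -> {for 0, continuous f}.
Proof.
move=> K0 f0 fK; apply/cvgrPdist_lt => eps eps0.
have K1 : 0 < K + 1 by rewrite ltr_wpDl.
have eK : 0 < eps / (K + 1) by rewrite divr_gt0.
apply: filterS (nbhsx_ballx (0 : V) _ eK) => y.
rewrite -ball_normE /ball_ /= sub0r normrN => y0.
rewrite f0 sub0r normrN; apply: (le_lt_trans (fK y)).
move: y0; rewrite ltr_pdivlMr// => /(le_lt_trans _); apply.
by rewrite mulrC ler_wpM2l// lerDl.
Qed.

Record admissible {R : realType} {n : nat} (Phi : 'rV[R]_n -> R) : Prop := Admissible {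
  adm_hom : homogeneous2 Phi;
  adm_convex : @convex_function R 'rV[R]_n setT Phi;
  adm_even : even_fun Phi;
  adm_C3 : Ck 3 [set x | x != 0] Phi;
  adm_det : forall x, x != 0 -> 0 < \det (hessian Phi x) }.

Section potential.
Context {R : realType} {n : nat} {Phi : 'rV[R]_n -> R} (H : admissible Phi).
Local Notation p := (partial Phi).
Local Notation e i := (delta_mx ord0 i : 'rV[R]_n).

Lemma nbhs_neq0 (x : 'rV[R]_n) : x != 0 -> \forall y \near x, y != 0.
Proof.
move=> x0; have x0' : 0 < `|x| by rewrite normr_gt0.
apply: filterS (nbhsx_ballx x _ x0') => y; rewrite mx_norm_ball /ball_ /= => xy.
by apply: contraTN xy => /eqP ->; rewrite subr0 ltxx.
Qed.

Lemma potential_continuous (x : 'rV[R]_n) : x != 0 -> {for x, continuous Phi}.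
Proof. by move=> x0; have [/(_ x x0)] := adm_C3 H. Qed.

Lemma potential_derivable (x : 'rV[R]_n) i : x != 0 -> derivable Phi x (e i).
Proof. by move=> x0; have [_ /(_ i)[/(_ x x0)]] := adm_C3 H. Qed.

Lemma partial_continuous_neq0 (x : 'rV[R]_n) i : x != 0 -> {for x, continuous (p i)}.
Proof. by move=> x0; have [_ /(_ i)[_ [/(_ x x0)]]] := adm_C3 H. Qed.

Lemma partial_derivable_neq0 (x : 'rV[R]_n) i j : x != 0 -> derivable (p j) x (e i).
Proof. by move=> x0; have [_ /(_ j)[_ [_ /(_ i)[/(_ x x0)]]]] := adm_C3 H. Qed.

Lemma partial2_continuous (x : 'rV[R]_n) i j : x != 0 -> {for x, continuous (partial (p j) i)}.
Proof. by move=> x0; have [_ /(_ j)[_ [_ /(_ i)[_ [/(_ x x0)]]]]] := adm_C3 H. Qed.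

Lemma is_derive_potential (x : 'rV[R]_n) v : x != 0 -> is_derive x v Phi (\sum_i v ord0 i * p i x).
Proof.
move=> x0; apply: is_derive_partials => i; last exact: partial_continuous_neq0.
by apply: filterS (nbhs_neq0 x0) => y; exact: potential_derivable.
Qed.

Lemma is_derive_partial (x : 'rV[R]_n) v j : x != 0 ->
  is_derive x v (p j) (\sum_i v ord0 i * hessian Phi x i j).
Proof.
move=> x0; rewrite (eq_bigr (fun i => v ord0 i * partial (p j) i x)); last first.
  by move=> i _; rewrite mxE.
apply: is_derive_partials => i; last exact: partial2_continuous.
by apply: filterS (nbhs_neq0 x0) => y; exact: partial_derivable_neq0.
Qed.

Lemma hessian_sym (x : 'rV[R]_n) : x != 0 -> (hessian Phi x)^T = hessian Phi x.
Proof.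
move=> x0; apply/matrixP => i j; rewrite !mxE; apply: derive_comm.
- apply: filterS (nbhs_neq0 x0) => y y0.
  by split; [exact: potential_derivable|exact: partial_derivable_neq0].
- apply: filterS (nbhs_neq0 x0) => y y0.
  by split; [exact: potential_derivable|exact: partial_derivable_neq0].
- exact: partial2_continuous.
- exact: partial2_continuous.
Qed.

Lemma derive2_potential (x : 'rV[R]_n) u : x != 0 ->
  'D_u ('D_u Phi) x = quadform (hessian Phi x) u /\
  derivable ('D_u Phi) x u.
Proof.
move=> x0; have D : is_derive x u (fun y => \sum_j u ord0 j * p j y)
    (quadform (hessian Phi x) u).
  rewrite quadform_sum.
  by apply: is_derive_scalar_sum => j; exact: is_derive_partial.
have N : \forall y \near x, \sum_j u ord0 j * p j y = 'D_u Phi y.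
  by apply: filterS (nbhs_neq0 x0) => y y0; have [_ ->] := is_derive_potential u y0.
by have [? ?] := near_eq_is_derive N D.
Qed.

Lemma hessian_psd (x : 'rV[R]_n) u : x != 0 -> 0 <= quadform (hessian Phi x) u.
Proof.
move=> x0; have [<- _] := derive2_potential u x0.
apply: (convex_derive2_ge0 (adm_convex H)).
  apply: filterS (nbhs_neq0 x0) => y y0; split.
    by have [] := is_derive_potential u y0.
  by have [] := derive2_potential u y0.
have N : \forall y \near x, \sum_i \sum_j u ord0 i * u ord0 j * partial (p j) i y =
    'D_u ('D_u Phi) y.
  apply: filterS (nbhs_neq0 x0) => y y0; have [-> _] := derive2_potential u y0.
  rewrite quadformE; apply: eq_bigr => i _; apply: eq_bigr => j _; by rewrite mxE.
have C : {for x, continuous (fun y =>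
    \sum_i \sum_j u ord0 i * u ord0 j * partial (p j) i y)}.
  apply: continuous_at_sum => i; apply: continuous_at_sum => j.
  by apply: continuous_at_scale; exact: partial2_continuous.
rewrite /prop_for /continuous_at -(nbhs_singleton N).
by apply: cvg_trans C; exact: near_eq_cvg N.
Qed.

Lemma hessian_posdef (x : 'rV[R]_n) : x != 0 -> posdef (hessian Phi x).
Proof.
move=> x0; apply: psd_det_posdef; first exact: hessian_sym.
  by move=> w; exact: hessian_psd.
by rewrite gt_eqF// (adm_det H).
Qed.

Lemma potential_hom : homogeneous_of 2 Phi. Proof. exact: adm_hom H. Qed.

Lemma potential0 : Phi 0 = 0.
Proof.
have := potential_hom 0 (ltr0Sn R 1); rewrite scaler0 => /eqP.
rewrite -subr_eq0 -[X in X - _]mul1r -mulrBl mulf_eq0 => /orP[/eqP|/eqP //]; lra.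
Qed.

Lemma partial_hom_neq0 i (t : R) x : 0 < t -> x != 0 -> p i (t *: x) = t ^+ 1 * p i x.
Proof.
by apply: partial_homogeneous => [|y y0]; [exact: potential_hom|exact: potential_derivable].
Qed.

Lemma euler_potential (x : 'rV[R]_n) : x != 0 -> \sum_i x ord0 i * p i x = 2 * Phi x.
Proof.
move=> x0; have [_ <-] := is_derive_potential x x0.
by have [_ ->] := euler_homogeneous x potential_hom.
Qed.

(** Evenness extends the homogeneity to negative factors. The potential is
    therefore a quadratic monomial on each axis, and differentiable along it at
    the origin. *)
Lemma potential_axis i (t : R) : Phi (t *: e i) = t ^+ 2 * Phi (e i).
Proof.
have [t0|t0|->] := ltgtP t 0; last by rewrite scale0r potential0 expr0n mul0r.
  rewrite -[t]opprK scaleNr (adm_even H) (adm_hom H) ?oppr_gt0//.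
  by rewrite !sqrrN.
exact: (adm_hom H).
Qed.

Lemma is_derive_potential0 i : is_derive (0 : 'rV[R]_n) (e i) Phi 0.
Proof.
have E : (fun h : R => h^-1 *: ((Phi \o shift 0) (h *: e i) - Phi 0)) =
    (fun h : R => h^-1 * (h ^+ 2 * Phi (e i))).
  by apply/funext => h /=; rewrite addr0 potential0 subr0 potential_axis.
have C : (fun h : R => h^-1 * (h ^+ 2 * Phi (e i))) h @[h --> 0^'] --> (0 : R).
  have N : \forall h \near (0 : R)^', h * Phi (e i) = h^-1 * (h ^+ 2 * Phi (e i)).
    near=> h; rewrite mulrA expr2 mulrA mulVf ?mul1r//.
    by near: h; exact: nbhs_dnbhs_neq.
  have I : (fun h : R => h) h @[h --> 0^'] --> (0 : R).
    by apply: cvg_within; exact: cvg_id.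
  have L : (fun h : R => h * Phi (e i)) h @[h --> 0^'] --> (0 * Phi (e i) : R).
    exact: (cvgM I (cvg_cst _)).
  rewrite mul0r in L; exact: (cvg_trans (near_eq_cvg N) L).
split; rewrite /derivable /derive E.
  by apply/cvg_ex; exists 0; exact: C.
exact: cvg_lim C.
Unshelve. all: by end_near. Qed.

Lemma partial0 i : p i 0 = 0.
Proof. by have [_] := is_derive_potential0 i. Qed.

Lemma partial_odd i x : p i (- x) = - p i x.
Proof.
have [->|x0] := eqVneq x 0; first by rewrite oppr0 partial0 oppr0.
have D : derivable Phi x (e i) by exact: potential_derivable.
have := @is_derive_scale_dir R _ Phi x (e i) (-1) D; rewrite mulN1r scaleN1r => -[D1 D2].
rewrite -D2 /partial /derive.
suff -> : (fun h : R => h^-1 *: ((Phi \o shift (- x)) (h *: e i) - Phi (- x))) =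
  (fun h : R => h^-1 *: ((Phi \o shift x) (h *: - e i) - Phi x)) by [].
apply/funext => h /=; rewrite (adm_even H); congr (_ *: (_ - _)).
by rewrite -(adm_even H) opprD opprK scalerN.
Qed.

(** Likewise the gradient, odd and 1-homogeneous, is linear on each axis. *)
Lemma partial_axis i j (t : R) : p j (t *: e i) = t * p j (e i).
Proof.
have ei0 : e i != 0.
  by apply/eqP => /matrixP/(_ ord0 i); rewrite !mxE !eqxx => /eqP; rewrite oner_eq0.
have [t0|t0|->] := ltgtP t 0; last by rewrite scale0r partial0 mul0r.
  rewrite -[t]opprK scaleNr partial_odd partial_hom_neq0 ?oppr_gt0// expr1.
  by rewrite !mulNr.
by rewrite partial_hom_neq0.
Qed.

Lemma is_derive_partial0 i j : is_derive (0 : 'rV[R]_n) (e i) (p j) (p j (e i)).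
Proof.
have E : (fun h : R => h^-1 *: ((p j \o shift 0) (h *: e i) - p j 0)) =
    (fun h : R => h^-1 * (h * p j (e i))).
  by apply/funext => h /=; rewrite addr0 partial0 subr0 partial_axis.
have C : (fun h : R => h^-1 * (h * p j (e i))) h @[h --> 0^'] --> p j (e i).
  have N : \forall h \near (0 : R)^', p j (e i) = h^-1 * (h * p j (e i)).
    near=> h; rewrite mulrA mulVf ?mul1r//.
    by near: h; exact: nbhs_dnbhs_neq.
  have L : (fun h : R => p j (e i)) h @[h --> 0^'] --> (p j (e i) : R).
    exact: cvg_cst.
  exact: (cvg_trans (near_eq_cvg N) L).
split; rewrite /derivable /derive E.
  by apply/cvg_ex; eexists; exact: C.
exact: cvg_lim C.
Unshelve. all: by end_near. Qed.

(** The Hessian may be discontinuous at the origin, but its entries exist there,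
    so that products of partial derivatives are differentiated by the same formula
    at every point. *)
Lemma is_derive_partial_axis (x : 'rV[R]_n) i j : is_derive x (e i) (p j) (hessian Phi x i j).
Proof.
rewrite mxE; have [->|x0] := eqVneq x 0.
  by have [D1 D2] := is_derive_partial0 i j; exact/derivableP.
exact/derivableP/partial_derivable_neq0.
Qed.

Lemma is_derive_potential_axis (x : 'rV[R]_n) i : is_derive x (e i) Phi (p i x).
Proof.
have [->|x0] := eqVneq x 0; first by rewrite partial0; exact: is_derive_potential0.
exact/derivableP/potential_derivable.
Qed.

Lemma partial_bound : exists2 K : R, 0 <= K & forall i x, `|p i x| <= K * `|x|.
Proof.
have B i := @homogeneous_bound R n 1 (p i)
  (fun x => @partial_continuous_neq0 x i) (@partial_hom_neq0 i).
have K i := cid2 (B i).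
exists (\sum_i sval (K i)); first by apply: sumr_ge0 => i _; case: (K i).
move=> i x; have [->|x0] := eqVneq x 0; first by rewrite partial0 !normr0 mulr0.
have Ki : sval (K i) <= \sum_i sval (K i).
  by rewrite (bigD1 i)//= lerDl sumr_ge0// => k _; case: (K k).
apply: (@le_trans _ _ (sval (K i) * `|x|)); last exact: ler_wpM2r.
by case: (K i) => /= k k0 /(_ x x0); rewrite expr1.
Qed.

Lemma partial_hom j : homogeneous_of 1 (p j).
Proof.
move=> s y s0; have [->|y0] := eqVneq y 0; last exact: partial_hom_neq0.
by rewrite scaler0 partial0 mulr0.
Qed.

Lemma hessian_hom i j (t : R) x : 0 < t -> x != 0 ->
  partial (p j) i (t *: x) = t ^+ 0 * partial (p j) i x.
Proof.
move=> t0 x0.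
have D : derivable (p j) x (e i) by exact: partial_derivable_neq0.
by have [_] := is_derive_homogeneous (@partial_hom j) t0 D.
Qed.

Lemma euler_partial (x : 'rV[R]_n) j : x != 0 -> \sum_i x ord0 i * hessian Phi x i j = p j x.
Proof.
move=> x0; have [_ <-] := is_derive_partial x j x0.
by have [_ ->] := euler_homogeneous x (@partial_hom j); rewrite mul1r.
Qed.

Lemma hessian_bound : exists2 K : R, 0 <= K & forall i j x, `|hessian Phi x i j| <= K.
Proof.
have B (ij : 'I_n * 'I_n) : exists2 K : R, 0 <= K & forall x, `|hessian Phi x ij.1 ij.2| <= K.
  case: ij => i j; have [K K0 HK] := @homogeneous_bound R n 0 (partial (p j) i)
    (fun x => @partial2_continuous x i j) (@hessian_hom i j).
  exists (Num.max K `|hessian Phi 0 i j|); first by rewrite le_max K0.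
  move=> x /=; rewrite le_max; have [->|x0] := eqVneq x 0; first by rewrite lexx orbT.
  by apply/orP; left; have := HK x x0; rewrite expr0 mulr1 mxE.
have K ij := cid2 (B ij).
exists (\sum_ij sval (K ij)); first by apply: sumr_ge0 => i _; case: (K i).
move=> i j x; apply: (@le_trans _ _ (sval (K (i, j)))).
  by case: (K _) => /= k _; exact.
by rewrite (bigD1 (i, j))//= lerDl sumr_ge0// => k _; case: (K k).
Qed.

(** By Euler's identities, 2 Phi x is the Hessian at x evaluated on x. *)
Lemma potential_gt0 (x : 'rV[R]_n) : x != 0 -> 0 < Phi x.
Proof.
move=> x0; have [_ /(_ x x0)] := hessian_posdef x0.
rewrite quadform_sum.
under eq_bigr => j _ do rewrite (euler_partial j x0).
by rewrite euler_potential// pmulr_rgt0.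
Qed.

Lemma potential_lower_bound : exists2 c : R, 0 < c & forall x, c * `|x| ^+ 2 <= Phi x.
Proof.
have [c c0 Hc] := @homogeneous_lower_bound R n 2 Phi potential_continuous
  (fun t x t0 _ => potential_hom x t0) potential_gt0.
exists c => // x; have [->|x0] := eqVneq x 0; last exact: Hc.
by rewrite potential0 normr0 expr0n mulr0.
Qed.

Lemma partial_continuous i : continuous (p i).
Proof.
move=> x; have [->|x0] := eqVneq x 0; last exact: partial_continuous_neq0.
have [K K0 HK] := partial_bound.
by apply: (continuous_at_bound K0); [exact: partial0|exact: HK].
Qed.

Lemma potential_continuousT : continuous Phi.
Proof.
move=> x; have [->|x0] := eqVneq x 0; last exact: potential_continuous.
have E : Phi = (fun y : 'rV[R]_n => 2^-1 * (\sum_i y ord0 i * p i y)).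
  apply/funext => y; have [->|y0] := eqVneq y 0.
    by rewrite potential0 big1 ?mulr0// => i _; rewrite mxE mul0r.
  by rewrite euler_potential// mulKf.
have C : {for 0, continuous (fun y : 'rV[R]_n => 2^-1 * (\sum_i y ord0 i * p i y))}.
  apply: continuous_at_scale; apply: continuous_at_sum => i.
  exact: (cvgM (@coord_continuous _ _ _ _ _ _) (@partial_continuous i _)).
by move: C; rewrite -E.
Qed.

End potential.

(** * Lebesgue measure on the space of row vectors *)

Lemma coord_le_norm (R : realType) n (x : 'rV[R]_n) i : `|x ord0 i| <= `|x|.
Proof.
rewrite [leRHS]/Num.norm /= mx_normrE.
exact: (le_bigmax _ (fun ij : 'I_1 * 'I_n => `|x ij.1 ij.2|) (ord0, i)).
Qed.

Lemma norm_lt_coord (R : realType) n (x : 'rV[R]_n) (e : R) :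
  0 < e -> (forall i, `|x ord0 i| < e) -> `|x| < e.
Proof.
move=> e0 H; rewrite [ltLHS]/Num.norm /= mx_normrE; apply/bigmax_ltP; split => // -[j i] _ /=.
by rewrite ord1.
Qed.

Section lebesgue.
Context {R : realType}.
Local Open Scope ereal_scope.

Lemma measurable_coord_ball n (x : 'rV[R]_n) (r : R) :
  measurable [set y : 'rV[R]_n | forall i, (`|x ord0 i - y ord0 i| < r)%R].
Proof.
rewrite (_ : [set y | _] = \bigcap_(i in [set: 'I_n])
  ((fun y : 'rV[R]_n => y ord0 i) @^-1` (ball (x ord0 i) r))); last first.
  apply/seteqP; split => y /= xy i; first by move=> _; exact: xy.
  exact: (xy i Logic.I).
apply: fin_bigcap_measurable => // i _.
rewrite -[X in measurable X]setTI; apply: measurable_rV_coord => //.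
by apply: open_measurable; exact: ball_open.
Qed.

(** The Euclidean topology has a countable base of boxes with rational
    centres, so the product sigma-algebra contains the open sets. *)
Lemma open_measurable_rV n (U : set 'rV[R]_n) : open U -> measurable U.
Proof.
move=> oU; pose B (qk : 'rV[rat]_n * nat) := [set y : 'rV[R]_n | forall i,
  (`|ratr (qk.1 ord0 i) - y ord0 i| < qk.2.+1%:R^-1)%R].
have mB qk : measurable (B qk).
  have := @measurable_coord_ball n (map_mx ratr qk.1) (qk.2.+1%:R^-1).
  congr (measurable _); apply/seteqP; split => y /= By i.
    by have := By i; rewrite mxE.
  by rewrite mxE; exact: By.
rewrite (_ : U = \bigcup_qk (if `[< B qk `<=` U >] then B qk else set0)).
  apply: countable_bigcupT_measurable; first exact: countableP.
  by move=> qk; case: ifP.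
apply/seteqP; split => x; last by move=> [qk _]; case: ifPn => // /asboolP; exact.
move=> Ux; have /nbhs_normP[e /= e0 He] : nbhs x U by exact: open_nbhs_nbhs.
have [k /= ke] : exists k : nat, (k.+1%:R^-1 < e / 2)%R.
  have e20 : (0 < e / 2)%R by rewrite divr_gt0.
  have [k _ kP] := near_infty_natSinv_lt (PosNum e20).
  by exists k; exact: kP k (leqnn k).
have Q i : {q : rat | (`|ratr q - x ord0 i| < k.+1%:R^-1)%R}.
  apply: cid.
  have [|q] := @rat_in_itvoo R (x ord0 i - k.+1%:R^-1)%R (x ord0 i + k.+1%:R^-1)%R.
    by rewrite ltrD2l gtrN// invr_gt0.
  by rewrite in_itv /= => qx; exists q; rewrite ltr_distl.
exists ((\row_i sval (Q i))%R, k) => //=.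
have BU : B ((\row_i sval (Q i))%R, k) `<=` U.
  move=> y /= By; apply: He; rewrite /ball_ /=.
  apply: norm_lt_coord => // i; rewrite !mxE; have := By i; rewrite mxE => H1; case: (Q i) H1 => q /= H2 H1.
  rewrite (le_lt_trans (ler_distD (ratr q) _ _))// [ltRHS]splitr ltrD//.
    by rewrite distrC (lt_trans H2).
  exact: lt_trans H1 _.
rewrite ifT; last exact/asboolP.
by move=> i; rewrite /= mxE; case: (Q i).
Qed.

Lemma continuous_measurable_rV n (f : 'rV[R]_n -> R) : continuous f ->
  measurable_fun setT f.
Proof.
move=> /continuousP cf; apply: (measurability _ (RGenOpens.measurableE R)).
move=> _ [_ [a [b ->] <-]]; rewrite setTI; apply: open_measurable_rV.
exact/cf/interval_open.
Qed.

Lemma lebesgue_shift1 (c : R) (A : set (measurableTypeR R)) : measurable A ->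
  lebesgue_measure ((fun x : measurableTypeR R => (x + c)%R : measurableTypeR R) @^-1` A)
  = lebesgue_measure A.
Proof.
move=> mA; have mc : measurable_fun setT
    (fun x : measurableTypeR R => (x + c)%R : measurableTypeR R).
  by apply: measurable_funD => //; exact: measurable_cst.
pose M := measure_function_pushforward__canonical__measure_function_Measure
  (@lebesgue_measure R) mc.
rewrite -[LHS]/(M A); apply/esym; apply: lebesgue_measure_unique => //.
move=> _ [[a b] /= _ <-]; rewrite /M /= /pushforward.
have -> : (fun x : measurableTypeR R => (x + c)%R : measurableTypeR R) @^-1` `]a, b] =
    `](a - c)%R, (b - c)%R]%classic.
  by apply/seteqP; split => x /=; rewrite !in_itv/= ltrBlDr lerBrDr.
rewrite !lebesgue_measure_itv /= !lte_fin ltrD2r.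
by case: ifP => //; rewrite -!EFinD opprB addrA subrK.
Qed.
End lebesgue.

Section lebesgue.
Context {R : realType}.
Local Open Scope ereal_scope.

Lemma continuous_shiftr n (v : 'rV[R]_n) : continuous (fun x : 'rV[R]_n => (x + v)%R).
Proof. by move=> x; exact: (cvgD cvg_id (cvg_cst _)). Qed.

Lemma measurable_shiftr n (v : 'rV[R]_n) :
  measurable_fun setT (fun x : 'rV[R]_n => (x + v)%R).
Proof.
apply: measurable_fun_rV => i; apply: continuous_measurable_rV => x.
exact: (cvg_comp (fun x : 'rV[R]_n => (x + v)%R) (fun y : 'rV[R]_n => y ord0 i)
  (@continuous_shiftr n v x) (@coord_continuous _ _ _ _ _ _)).
Qed.

Lemma cons_rVD n (a : R) (x : 'rV[R]_n) (v : 'rV[R]_n.+1) :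
  (cons_rV ((a, x) : measurableTypeR R * 'rV[R]_n) + v)%R =
  cons_rV (((a + v ord0 ord0)%R, (x + (uncons_rV v).2)%R) : measurableTypeR R * 'rV[R]_n).
Proof.
apply/rowP => i; rewrite mxE.
have [j ->|->] := unliftP ord0 i.
  have E (p : measurableTypeR R * 'rV[R]_n) : cons_rV p ord0 (lift ord0 j) = p.2 ord0 j.
    rewrite (_ : lift ord0 j = rshift 1 j); last exact: val_inj.
    exact: (@row_mxEr _ 1 1 n).
  by rewrite !E !mxE; congr (_ + v _ _)%R; exact: val_inj.
have E (p : measurableTypeR R * 'rV[R]_n) : cons_rV p ord0 ord0 = p.1.
  by rewrite -[in RHS](cons_rVK p).
by rewrite !E.
Qed.

(** A measure on a product is determined by its values on rectangles, where the
    translated measure agrees with the original one by induction on the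
    dimension. *)
Lemma lebesgue_rV_shift n (v : 'rV[R]_n) (A : set 'rV[R]_n) : measurable A ->
  lebesgue_rV n ((fun x => (x + v)%R) @^-1` A) = lebesgue_rV n A.
Proof.
elim: n => [|n IH] in v A *.
  move=> _; congr (lebesgue_rV 0 _).
  by apply/seteqP; split => x /=; rewrite (_ : (x + v)%R = x)//; apply/rowP; case.
move=> mA; pose v' := (uncons_rV v).2; pose c := v ord0 ord0.
pose tau (q : measurableTypeR R * 'rV[R]_n) : measurableTypeR R * 'rV[R]_n :=
  ((q.1 + c)%R, (q.2 + v')%R).
have mtau : measurable_fun setT tau.
  apply: measurable_fun_pair.
    apply: (@measurable_funD _ _ R setT (fst : measurableTypeR R * 'rV[R]_n -> R) (cst c)).
      exact: measurable_fst.
    exact: measurable_cst.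
  exact: (measurableT_comp (@measurable_shiftr n v') measurable_snd).
pose P := [the {measure set _ -> \bar R} of (@lebesgue_measure R \x @lebesgue_rV R n)].
pose M := measure_function_pushforward__canonical__measure_function_Measure P mtau.
have mA' : measurable (@cons_rV R n @^-1` A).
  by rewrite -[X in measurable X]setTI; exact: measurable_cons_rV.
have -> : lebesgue_rV n.+1 ((fun x => (x + v)%R) @^-1` A) = M (@cons_rV R n @^-1` A).
  rewrite /M /= /pushforward; congr (product_measure1 _ _ _).
  by apply/seteqP; split => -[a x] /=; rewrite cons_rVD.
rewrite -(@product_measure_unique _ _ _ _ R (@lebesgue_measure R) (@lebesgue_rV R n) M)//.
move=> B C mB mC; rewrite /M /= /pushforward.
have -> : tau @^-1` (B `*` C) =
    ((fun x : measurableTypeR R => (x + c)%R : measurableTypeR R) @^-1` B) `*`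
    ((fun x : 'rV[R]_n => (x + v')%R) @^-1` C) by [].
have mB' : measurable ((fun x : measurableTypeR R => (x + c)%R : measurableTypeR R) @^-1` B).
  rewrite -[X in measurable X]setTI.
  by apply: measurable_funD => //; exact: measurable_cst.
have mC' : measurable ((fun x : 'rV[R]_n => (x + v')%R) @^-1` C).
  by rewrite -[X in measurable X]setTI; exact: measurable_shiftr.
by rewrite product_measure1E//; congr (_ * _); [exact: lebesgue_shift1|exact: IH].
Qed.

Lemma integral_shift n (v : 'rV[R]_n) (G : 'rV[R]_n -> \bar R) :
  measurable_fun setT G ->
  (lebesgue_rV n).-integrable setT (fun x => G (x + v)%R) ->
  \int[lebesgue_rV n]_x G (x + v)%R = \int[lebesgue_rV n]_x G x.
Proof.
move=> mG iG.
have E := @integral_pushforward _ _ _ _ R _ (@measurable_shiftr n v) (@lebesgue_rV R n)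
  setT G mG iG measurableT.
rewrite preimage_setT in E; rewrite -[LHS]/(\int[lebesgue_rV n]_x (G \o +%R^~ v) x) -E.
apply: (@eq_measure_integral _ _ _ _ (@lebesgue_rV R n)
  (measure_function_pushforward__canonical__measure_function_Measure
    (@lebesgue_rV R n) (@measurable_shiftr n v))) => A mA _.
exact: lebesgue_rV_shift.
Qed.

Lemma integral_expR_abs (a : R) : (0 < a)%R ->
  \int[@lebesgue_measure R]_t (expR (- (a * `|t|)))%:E < +oo.
Proof.
move=> a0; rewrite ge0_symfun_integralT; first last.
- by move=> t /=; rewrite normrN.
- move=> t; apply: continuous_comp; last exact: continuous_expR.
  apply: continuousN; apply: continuousM; first exact: cst_continuous.
  exact: norm_continuous.
- by move=> t; exact: expR_ge0.
rewrite lte_mul_pinfty//.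
have E : \int[@lebesgue_measure R]_(t in [set t | (0 <= t)%R]) (expR (- (a * `|t|)))%:E
    <= a^-1%:E * \int[@lebesgue_measure R]_t (exponential_pdf a t)%:E.
  rewrite -ge0_integralZl//; last 3 first.
  - by apply/measurable_EFinP; exact: measurable_exponential_pdf.
  - by move=> t _; rewrite lee_fin; exact: (exponential_pdf_ge0 (ltW a0)).
  - by rewrite lee_fin invr_ge0 ltW.
  have mpos : measurable [set t : R | (0 <= t)%R] by rewrite -set_itvcy.
  rewrite [leLHS](eq_integral (fun t : measurableTypeR R => a^-1%:E * (exponential_pdf a t)%:E)); last first.
    move=> t; rewrite inE /= => t0.
    by rewrite exponential_pdfE// -EFinM mulrA mulVf ?mul1r ?gt_eqF// ger0_norm// mulNr.
  apply: ge0_subset_integral => //.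
    apply: measurable_funeM; apply/measurable_EFinP; exact: measurable_exponential_pdf.
  move=> t _; rewrite -EFinM lee_fin; apply: mulr_ge0; first by rewrite invr_ge0 ltW.
  exact: (exponential_pdf_ge0 (ltW a0)).
by apply: (le_lt_trans E); rewrite integral_exponential_pdf// mule1 ltry.
Qed.

Lemma continuous_l1_weight n (a : R) :
  continuous (fun x : 'rV[R]_n => expR (- (a * \sum_i `|x ord0 i|))).
Proof.
move=> x.
have cS : {for x, continuous (fun x : 'rV[R]_n => - (a * \sum_i `|x ord0 i|))%R}.
  have c1 : {for x, continuous (fun x : 'rV[R]_n => (\sum_i `|x ord0 i|)%R)}.
    apply: continuous_at_sum => i.
    exact: (cvg_comp (fun y : 'rV[R]_n => y ord0 i) (fun t : R => `|t|%R)
      (@coord_continuous _ _ _ ord0 i x) (@norm_continuous _ R^o (x ord0 i))).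
  exact: (cvgN (continuous_at_scale c1)).
exact: (cvg_comp _ _ cS (@continuous_expR _ _)).
Qed.

Lemma integral_l1_weight n (a : R) : (0 < a)%R ->
  \int[lebesgue_rV n]_x (expR (- (a * \sum_i `|x ord0 i|)))%:E < +oo.
Proof.
move=> a0; elim: n => [|n IH].
  rewrite integral_dirac//=; first by rewrite diracT mul1e ltry.
  by apply/measurable_EFinP; apply: continuous_measurable_rV; exact: continuous_l1_weight.
have mW m : measurable_fun setT
    (fun x : 'rV[R]_m => (expR (- (a * \sum_i `|x ord0 i|)))%:E).
  by apply/measurable_EFinP; apply: continuous_measurable_rV; exact: continuous_l1_weight.
rewrite (@ge0_integral_pushforward _ _ _ _ R _ (@measurable_cons_rV R n)
  [the {measure set _ -> \bar R} of (@lebesgue_measure R \x @lebesgue_rV R n)])//; last first.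
  exact: mW.
pose f (q : measurableTypeR R * 'rV[R]_n) : \bar R :=
  (expR (- (a * `|q.1|)))%:E * (expR (- (a * \sum_i `|q.2 ord0 i|)))%:E.
have mE : measurable_fun setT (fun t : measurableTypeR R => (expR (- (a * `|t|)))%:E).
  apply/measurable_EFinP; apply: continuous_measurable_fun => t.
  apply: continuous_comp; last exact: continuous_expR.
  apply: continuousN; apply: continuousM; first exact: cst_continuous.
  exact: norm_continuous.
have fE : (fun x : 'rV[R]_n.+1 => (expR (- (a * \sum_i `|x ord0 i|)))%:E) \o @cons_rV R n = f.
  apply/funext => -[t x]; rewrite /f /= -EFinM -expRD; congr (expR _)%:E.
  rewrite big_ord_recl mulrDr opprD; congr (- (a * `|_|) + - (a * _))%R.
    by rewrite -[RHS]/((t, x).1) -[in RHS](cons_rVK (t, x)).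
  apply: eq_bigr => i _; congr (`|_|%R).
  rewrite (_ : lift ord0 i = rshift 1 i); last exact: val_inj.
  exact: (@row_mxEr _ 1 1 n).
rewrite preimage_setT fE.
have mf : measurable_fun setT f.
  by apply: emeasurable_funM; [exact: (measurableT_comp mE measurable_fst)|
    exact: (measurableT_comp (mW n) measurable_snd)].
rewrite fubini_tonelli1//; last first.
  by move=> q; rewrite /f -EFinM lee_fin mulr_ge0// expR_ge0.
rewrite /fubini_F /f /=.
pose I0 := \int[lebesgue_rV n]_x (expR (- (a * \sum_i `|x ord0 i|)))%:E.
rewrite (eq_integral (fun t : measurableTypeR R => (expR (- (a * `|t|)))%:E * I0)); last first.
  move=> t _; rewrite ge0_integralZl//; first exact: mW.
have I00 : 0 <= I0 by apply: integral_ge0 => x _; rewrite lee_fin expR_ge0.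
rewrite ge0_integralZr//.
apply: lte_mul_pinfty => //.
- by apply: integral_ge0 => x _; rewrite lee_fin expR_ge0.
- rewrite ge0_fin_numE; first exact: integral_expR_abs.
  by apply: integral_ge0 => x _; rewrite lee_fin expR_ge0.
Qed.

Lemma l1_le_norm n (x : 'rV[R]_n) : (\sum_i `|x ord0 i| <= n%:R * `|x|)%R.
Proof.
rewrite mulr_natl; apply: (le_trans (ler_sum _ (fun i _ => coord_le_norm x i))).
by rewrite sumr_const card_ord.
Qed.

(** The supremum norm dominates the l1 norm up to a factor, and the exponential
    of the l1 norm is a product of functions of one variable. *)
Lemma integrable_expR_norm n :
  (lebesgue_rV n).-integrable setT (fun x : 'rV[R]_n => (expR (- `|x|))%:E).
Proof.
have mN : measurable_fun setT (fun x : 'rV[R]_n => (expR (- `|x|))%:E).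
  apply/measurable_EFinP; apply: continuous_measurable_rV => x.
  have cN : {for x, continuous (fun x : 'rV[R]_n => - `|x|)%R}.
    exact: (cvgN (@norm_continuous _ _ x)).
  exact: (cvg_comp _ _ cN (@continuous_expR _ _)).
have a0 : (0 < n.+1%:R^-1 :> R)%R by rewrite invr_gt0.
apply/integrableP; split=> //; apply: le_lt_trans (integral_l1_weight n a0).
apply: ge0_le_integral => //.
- by apply: measurableT_comp.
- by apply/measurable_EFinP; apply: continuous_measurable_rV; exact: continuous_l1_weight.
move=> x _; rewrite gee0_abs ?lee_fin ?expR_ge0// ler_expR lerN2.
rewrite ler_pdivrMl// (le_trans (l1_le_norm x))// ler_wpM2r//.
by rewrite ler_nat.
Qed.

End lebesgue.

(** * Integrals of derivatives *)

Section integration.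
Context {R : realType}.
Local Open Scope ereal_scope.

Lemma cvg_invn_dnbhs : (k.+1%:R^-1 : R)%R @[k --> \oo] --> ((0%R : R)^')%classic.
Proof.
move=> A; rewrite /dnbhs /within /= => NA.
have C : (k.+1%:R^-1 : R)%R @[k --> \oo] --> (0%R : R) by exact: cvg_harmonic.
have N : \forall k \near \oo, ((k.+1%:R^-1 : R) != 0 -> A (k.+1%:R^-1 : R))%R.
  exact: C _ NA.
by apply: filterS N => k /=; apply; rewrite invr_eq0 pnatr_eq0.
Qed.

Lemma norm_expR_bound_integrable n (G : 'rV[R]_n -> R) (C : R) :
  measurable_fun setT G -> (forall x, (`|G x| <= C * expR (- `|x|))%R) ->
  (lebesgue_rV n).-integrable setT (EFin \o G).
Proof.
move=> mG GC.
have iK : (lebesgue_rV n).-integrable setT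
    (fun x : 'rV[R]_n => C%:E * (expR (- `|x|))%:E).
  exact: (integrableZl measurableT _ (@integrable_expR_norm R n)).
apply: (le_integrable measurableT _ _ iK); first exact/measurable_EFinP.
by move=> x _ /=; rewrite lee_fin; apply: (le_trans (GC x)); exact: ler_norm.
Qed.

Lemma cvg_difference_quotient n (G : 'rV[R]_n -> R) (v x : 'rV[R]_n) :
  derivable G x v ->
  (k.+1%:R * (G (x + k.+1%:R^-1 *: v) - G x))%R @[k --> \oo] --> ('D_v G x : R).
Proof.
move=> dG.
have D : (fun h : R => h^-1 *: ((G \o shift x) (h *: v) - G x))%R h
    @[h --> (0%R : R)^'%classic] --> ('D_v G x : R) by exact: dG.
rewrite (_ : (fun k => _) = (fun h : R => h^-1 *: ((G \o shift x) (h *: v) - G x))%R \o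
    (fun k => k.+1%:R^-1 : R)%R).
  exact: (cvg_comp _ _ cvg_invn_dnbhs D).
by apply/funext => k; rewrite /= invrK [(_ *: v + x)%R]addrC.
Qed.

Lemma measurable_difference_quotient n (G : 'rV[R]_n -> R) (v : 'rV[R]_n) k :
  measurable_fun setT G ->
  measurable_fun setT (fun x : 'rV[R]_n => k.+1%:R * (G (x + k.+1%:R^-1 *: v) - G x))%R.
Proof.
move=> mG; apply: measurable_funM; first exact: measurable_cst.
apply: measurable_funB => //.
exact: (measurableT_comp mG (@measurable_shiftr R n _)).
Qed.

(** A derivative is a pointwise limit of difference quotients, even where it is
    discontinuous. *)
Lemma measurable_derive n (G : 'rV[R]_n -> R) (v : 'rV[R]_n) :
  measurable_fun setT G -> (forall x, derivable G x v) -> measurable_fun setT ('D_v G).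
Proof.
move=> mG dG.
apply: (measurable_fun_cvg (fun k => @measurable_difference_quotient n G v k mG)).
by move=> x _; exact: cvg_difference_quotient.
Qed.

(** Translation invariance makes the integral of every difference quotient
    vanish; the mean value theorem dominates the quotients. *)
Lemma integral_derive0 n (G : 'rV[R]_n -> R) (v : 'rV[R]_n) (C : R) :
  continuous G -> (forall x, derivable G x v) ->
  (forall x, (`|G x| <= C * expR (- `|x|))%R) ->
  (forall x, (`|'D_v G x| <= C * expR (- `|x|))%R) ->
  \int[lebesgue_rV n]_x ('D_v G x)%:E = 0.
Proof.
move=> cG dG GC DC.
have C0 : (0 <= C)%R.
  by have := le_trans (normr_ge0 _) (GC 0%R); rewrite normr0 oppr0 expR0 mulr1.
pose f (k : nat) (x : 'rV[R]_n) := (k.+1%:R * (G (x + k.+1%:R^-1 *: v) - G x))%R.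
have mG : measurable_fun setT G by exact: continuous_measurable_rV.
have mGs (w : 'rV[R]_n) : measurable_fun setT (fun x : 'rV[R]_n => G (x + w)%R).
  exact: (measurableT_comp mG (@measurable_shiftr R n w)).
have mf k : measurable_fun setT (f k) by exact: measurable_difference_quotient.
have f_cvg x : f k x @[k --> \oo] --> ('D_v G x : R) by exact: cvg_difference_quotient.
have mD : measurable_fun setT ('D_v G) by exact: measurable_derive.
have shiftC (s : R) (x : 'rV[R]_n) : (`|s| <= 1)%R ->
    (expR (- `|x + s *: v|) <= expR `|v| * expR (- `|x|))%R.
  move=> s1; rewrite -expRD ler_expR.
  have : (`|x| <= `|x + s *: v| + `|v|)%R.
    rewrite -[x in leLHS](addrK (s *: v)); apply: (le_trans (ler_normB _ _)).
    by rewrite lerD2l normrZ ler_piMl.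
  by move: `|_|%R `|_|%R `|_|%R => a b c; lra.
pose K := (C * expR `|v|)%R.
have fK k x : (`|f k x| <= K * expR (- `|x|))%R.
  have [s sk E] := @MVT_line R _ G x v (k.+1%:R^-1) (fun s _ => dG _).
  rewrite /f E mulrA mulfV ?pnatr_eq0// mul1r; apply: (le_trans (DC _)).
  rewrite /K -mulrA ler_wpM2l//; apply: shiftC; apply: (le_trans sk).
  by rewrite ger0_norm ?invr_ge0// invf_le1// ler1n.
have iG : (lebesgue_rV n).-integrable setT (EFin \o G).
  exact: (norm_expR_bound_integrable mG GC).
have iGs k : (lebesgue_rV n).-integrable setT (fun x : 'rV[R]_n => (G (x + k.+1%:R^-1 *: v)%R)%:E).
  apply: (@norm_expR_bound_integrable n (fun x : 'rV[R]_n => G (x + k.+1%:R^-1 *: v)%R) K) => // x.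
  apply: (le_trans (GC _)); rewrite /K -mulrA ler_wpM2l//; apply: shiftC.
  by rewrite ger0_norm ?invr_ge0// invf_le1// ler1n.
have f0 k : \int[lebesgue_rV n]_x (f k x)%:E = 0.
  under eq_integral => x _ do rewrite /f EFinM EFinB.
  rewrite integralZl//; last by apply: integrableB.
  have E1 : \int[lebesgue_rV n]_x (G (x + k.+1%:R^-1 *: v)%R)%:E =
      \int[lebesgue_rV n]_x (G x)%:E.
    by apply: (@integral_shift R n _ (EFin \o G)); [exact/measurable_EFinP|exact: iGs].
  rewrite integralB_EFin//; last exact: iGs.
  rewrite [X in _ * (X - _)]E1.
  by rewrite subee ?mule0// integrable_fin_num.
have iK : (lebesgue_rV n).-integrable setT (fun x : 'rV[R]_n => (K * expR (- `|x|))%:E).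
  by under eq_fun do rewrite EFinM; exact: (integrableZl measurableT _ (@integrable_expR_norm R n)).
have [||||_ _] := @dominated_convergence _ _ _ (lebesgue_rV n) setT measurableT
  (fun k x => (f k x)%:E) (EFin \o 'D_v G) (fun x : 'rV[R]_n => (K * expR (- `|x|))%:E) _ _ _ iK.
- by move=> k; exact/measurable_EFinP.
- exact/measurable_EFinP.
- by apply: aeW => x _; apply: cvg_EFin; [exact: nearW|exact: f_cvg].
- by apply: aeW => x k _; rewrite lee_fin.
under eq_fun do rewrite f0; move=> L.
have := cvg_lim (@ereal_hausdorff R) L; by rewrite lim_cst//; move=> <-.
Qed.

(** The function is bounded below by half its value at x0 on a small box, whose
    volume is positive. *)
Lemma integral_gt0 n (g : 'rV[R]_n -> R) (x0 : 'rV[R]_n) :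
  measurable_fun setT g -> (forall x, (0 <= g x)%R) ->
  {for x0, continuous g} -> (0 < g x0)%R ->
  0 < \int[lebesgue_rV n]_x (g x)%:E.
Proof.
move=> mg g0 cg gx0.
have g2 : (g x0 / 2 < g x0)%R by rewrite ltr_pdivrMr// ltr_pMr// ltr1n.
have /nbhs_normP[e /= e0 He] : \forall x \near x0, (g x0 / 2 < g x)%R.
  exact: (cvgr_gt _ cg _ g2).
pose a : 'rV[R]_n := (\row_i (x0 ord0 i - e / 2))%R.
pose b : 'rV[R]_n := (\row_i (x0 ord0 i + e / 2))%R.
have ab i : (a ord0 i <= b ord0 i)%R.
  by rewrite !mxE lerD2l ge0_cp// divr_ge0// ltW.
pose B := [set x : 'rV[R]_n | forall i, x ord0 i \in `[a ord0 i, b ord0 i]].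
have mB : measurable B.
  rewrite (_ : B = \bigcap_(i in [set: 'I_n])
    ((fun x : 'rV[R]_n => x ord0 i) @^-1` `[a ord0 i, b ord0 i])); last first.
    by apply/seteqP; split => [x H i _|x H i]; [exact: H|exact: (H i Logic.I)].
  apply: fin_bigcap_measurable => // i _.
  by rewrite -[X in measurable X]setTI; exact: measurable_rV_coord.
have Bg x : B x -> (g x0 / 2 <= g x)%R.
  move=> Bx; apply/ltW/He; rewrite /ball_ /=; apply: norm_lt_coord => // i.
  have := Bx i; rewrite !mxE in_itv /= => /andP[]; move: (x ord0 i) (x0 ord0 i) => s t.
  by move=> h1 h2; rewrite ltr_norml; apply/andP; split; lra.
have : \int[lebesgue_rV n]_(x in B) (g x0 / 2)%:E <= \int[lebesgue_rV n]_x (g x)%:E.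
  apply: (@le_trans _ _ (\int[lebesgue_rV n]_(x in B) (g x)%:E)).
    apply: ge0_le_integral => //.
    - by move=> x _; rewrite lee_fin divr_ge0.
    - by apply/measurable_EFinP; exact: measurable_funTS.
  apply: ge0_subset_integral => //; first exact/measurable_EFinP.
  by move=> x _; rewrite lee_fin.
apply: lt_le_trans; rewrite integral_cst//; apply: mule_gt0.
  by rewrite lte_fin divr_gt0.
rewrite [ltRHS]lebesgue_rV_box// lte_fin prodr_gt0// => i _.
by rewrite !mxE; move: (x0 ord0 i) => t; lra.
Qed.

End integration.

(** * The Gibbs measure *)

Section density.
Context d (T : measurableType d) (R : realType).
Local Open Scope ereal_scope.

(** The density w is almost everywhere equal to the Radon-Nikodym derivative. *)
Lemma ge0_integral_density (lam : {sigma_finite_measure set T -> \bar R})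
    (P : probability T R) (w : T -> R) (g : T -> \bar R) :
  measurable_fun setT w ->
  (forall A, measurable A -> P A = \int[lam]_(x in A) (w x)%:E) ->
  measurable_fun setT g -> (forall x, 0 <= g x) ->
  \int[P]_x g x = \int[lam]_x (g x * (w x)%:E).
Proof.
move=> mw PE mg g0.
have dom : P `<< lam.
  apply/null_content_dominatesP => A mA A0; rewrite PE//.
  by apply: null_set_integral => //; apply/measurable_EFinP; exact: measurable_funTS.
have ae : ae_eq lam setT (Radon_Nikodym_SigmaFinite.f P lam) (EFin \o w).
  apply: integral_ae_eq => //.
  - exact: Radon_Nikodym_SigmaFinite.f_integrable.
  - exact/measurable_EFinP.
  - move=> A _ mA; rewrite -Radon_Nikodym_SigmaFinite.f_integral//; exact: PE.
rewrite -(Radon_Nikodym_SigmaFinite.change_of_variables dom g0 measurableT mg).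
apply: ae_eq_integral => //.
- apply: emeasurable_funM => //.
  exact: measurable_int (Radon_Nikodym_SigmaFinite.f_integrable dom).
- by apply: emeasurable_funM => //; exact/measurable_EFinP.
- by apply: filterS ae => x /= /[apply] ->.
Qed.

Lemma integrable_sqr_Lfun (P : probability T R) (f : T -> R) :
  measurable_fun setT f -> P.-integrable setT (fun x => (f x ^+ 2)%:E) ->
  f \in Lfun P 2%:E.
Proof.
move=> mf /integrableP[_ i2]; apply/andP; split; rewrite inE//.
rewrite /= /finite_norm unlock /=; apply: poweR_lty; apply: le_lt_trans i2.
rewrite le_eqVlt; apply/orP; left; apply/eqP; apply: eq_integral => x _ /=.
by rewrite powR_mulrn ?normr_ge0// normrX.
Qed.

End density.

Section tame.
Context {R : realType} {n : nat}.
Implicit Types f g : 'rV[R]_n -> R.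

(** At most exponential growth, rather than polynomial: it is stable under
    products, and a Gaussian weight beats it in one completion of a square. *)
Definition tame f := measurable_fun setT f /\
  exists C a : R, [/\ 0 <= C, 0 <= a & forall x, `|f x| <= C * expR (a * `|x|)].

Lemma tame_cst (c : R) : tame (fun=> c).
Proof.
split; first exact: measurable_cst.
by exists `|c|, 0; split => // x; rewrite mul0r expR0 mulr1.
Qed.

Lemma tameD f g : tame f -> tame g -> tame (fun x => f x + g x).
Proof.
move=> [mf [C [a [C0 a0 fC]]]] [mg [D [b [D0 b0 gD]]]].
split; first exact: measurable_funD.
exists (C + D), (a + b); split; [exact: addr_ge0|exact: addr_ge0|move=> x].
rewrite (le_trans (ler_normD _ _))// mulrDl lerD//.
  by rewrite (le_trans (fC x))// ler_wpM2l// ler_expR ler_wpM2r// lerDl.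
by rewrite (le_trans (gD x))// ler_wpM2l// ler_expR ler_wpM2r// lerDr.
Qed.

Lemma tameM f g : tame f -> tame g -> tame (fun x => f x * g x).
Proof.
move=> [mf [C [a [C0 a0 fC]]]] [mg [D [b [D0 b0 gD]]]].
split; first exact: measurable_funM.
exists (C * D), (a + b); split; [exact: mulr_ge0|exact: addr_ge0|move=> x].
by rewrite normrM mulrDl expRD mulrACA ler_pM.
Qed.

Lemma tameN f : tame f -> tame (fun x => - f x).
Proof.
move=> [mf [C [a [C0 a0 fC]]]]; split; first exact: measurableT_comp.
by exists C, a; split => // x; rewrite normrN.
Qed.

Lemma tame_norm f : tame f -> tame (fun x => `|f x|).
Proof.
move=> [mf [C [a [C0 a0 fC]]]]; split; first exact: measurableT_comp.
by exists C, a; split => // x; rewrite normr_id.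
Qed.

Lemma tameB f g : tame f -> tame g -> tame (fun x => f x - g x).
Proof. by move=> tf tg; apply: tameD => //; exact: tameN. Qed.

Lemma tameZ (c : R) f : tame f -> tame (fun x => c * f x).
Proof. by apply: tameM; exact: tame_cst. Qed.

Lemma tame_sum (I : Type) (s : seq I) (F : I -> 'rV[R]_n -> R) :
  (forall i, tame (F i)) -> tame (fun x => \sum_(i <- s) F i x).
Proof.
move=> tF; elim: s => [|i s IH].
  rewrite (_ : (fun x => _) = (fun=> 0)); first exact: tame_cst.
  by apply/funext => x; rewrite big_nil.
rewrite (_ : (fun x => _) = (fun x => F i x + \sum_(j <- s) F j x)).
  exact: tameD.
by apply/funext => x; rewrite big_cons.
Qed.

Lemma tame_linear_growth f (K : R) : 0 <= K -> measurable_fun setT f ->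
  (forall x, `|f x| <= K * `|x|) -> tame f.
Proof.
move=> K0 mf fK; split=> //; exists K, 1; split => // x.
rewrite (le_trans (fK x))// ler_wpM2l// mul1r.
by rewrite (le_trans _ (expR_ge1Dx _))// lerDr.
Qed.

Lemma tame_bounded f (K : R) : 0 <= K -> measurable_fun setT f ->
  (forall x, `|f x| <= K) -> tame f.
Proof.
move=> K0 mf fK; split=> //; exists K, 0; split => // x.
by rewrite mul0r expR0 mulr1.
Qed.

Lemma tame_coord i : tame (fun x => x ord0 i).
Proof.
apply: (@tame_linear_growth _ 1) => //; first exact: measurable_rV_coord.
by move=> x; rewrite mul1r coord_le_norm.
Qed.

End tame.

Section gibbs.
Context {R : realType} {n : nat} {Phi : 'rV[R]_n -> R} {mu : probability 'rV[R]_n R}.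
Context (H : admissible Phi) (mu_gibbs : is_gibbs Phi mu).
Implicit Types f g : 'rV[R]_n -> R.
Local Notation p := (partial Phi).
Local Notation e i := (delta_mx ord0 i : 'rV[R]_n).
Local Notation lam := (lebesgue_rV n).

Lemma continuous_weight : continuous (fun x => expR (- Phi x)).
Proof.
move=> x; have cN : {for x, continuous (fun x => - Phi x)}.
  exact: (cvgN (@potential_continuousT _ _ _ H x)).
exact: (cvg_comp _ _ cN (@continuous_expR _ _)).
Qed.

Lemma measurable_weight : measurable_fun setT (fun x => expR (- Phi x)).
Proof. by apply: continuous_measurable_rV; exact: continuous_weight. Qed.

Lemma tame_partial i : tame (p i).
Proof.
have [K K0 HK] := partial_bound H.
apply: (tame_linear_growth K0); last exact: HK.
by apply: continuous_measurable_rV; exact: partial_continuous.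
Qed.

Lemma tame_hessian i j : tame (fun x => hessian Phi x i j).
Proof.
have [K K0 HK] := hessian_bound H.
apply: (tame_bounded K0); last exact: HK.
rewrite (_ : (fun x => _) = 'D_(e i) (p j)); last first.
  by apply/funext => x; rewrite mxE.
apply: measurable_derive; first exact: (tame_partial j).1.
by move=> x; have [] := is_derive_partial_axis H x i j.
Qed.

Lemma tame_potential : tame Phi.
Proof.
rewrite (_ : Phi = fun x => 2^-1 * \sum_i x ord0 i * p i x).
  apply: tameZ; apply: tame_sum => i; apply: tameM; first exact: tame_coord.
  exact: tame_partial.
apply/funext => x; have [->|x0] := eqVneq x 0.
  by rewrite (potential0 H) big1 ?mulr0// => i _; rewrite mxE mul0r.
by rewrite (euler_potential H)// mulKf.
Qed.

(** The potential grows quadratically, hence beats every exponential. *)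
Lemma tame_weight_bound f : tame f ->
  exists2 C : R, 0 <= C & forall x, `|f x * expR (- Phi x)| <= C * expR (- `|x|).
Proof.
move=> [mf [C [a [C0 a0 fC]]]]; have [c c0 Hc] := potential_lower_bound H.
set D := (a + 1) ^+ 2 / (4 * c).
exists (C * expR D); first by rewrite mulr_ge0// expR_ge0.
move=> x; rewrite normrM [X in _ * X]ger0_norm ?expR_ge0//.
apply: (@le_trans _ _ (C * expR (a * `|x|) * expR (- Phi x))).
  by rewrite ler_wpM2r// expR_ge0.
rewrite -!mulrA -!expRD ler_wpM2l// ler_expR.
move: (`|x|) (Phi x) (Hc x) => s q sq.
(* a s - c s ^+ 2 + s is at most its maximum over s *)
have : 0 <= (c * s - (a + 1) / 2) ^+ 2 / c by rewrite divr_ge0 ?sqr_ge0// ltW.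
have -> : (c * s - (a + 1) / 2) ^+ 2 / c =
   c * s ^+ 2 - (a + 1) * s + D by rewrite /D; field; rewrite gt_eqF.
rewrite [(a + 1) * s]mulrDl mul1r.
by move: sq; move: D (c * s ^+ 2) (a * s) => D' S A sq D0; lra.
Qed.

Lemma integrable_weight f : tame f ->
  lam.-integrable setT (EFin \o (fun x => f x * expR (- Phi x))).
Proof.
move=> tf; have [C C0 HC] := tame_weight_bound tf.
apply: (norm_expR_bound_integrable _ HC).
by apply: measurable_funM; [exact: tf.1|exact: measurable_weight].
Qed.

Let Z := fine (\int[lam]_x (expR (- Phi x))%:E)%E.

Lemma partition_fin : (\int[lam]_x (expR (- Phi x))%:E)%E = Z%:E.
Proof.
have := integrable_weight (tame_cst 1).
under eq_fun do rewrite mul1r.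
by move=> i1; rewrite fineK// integrable_fin_num.
Qed.

Lemma partition_neq0 : Z != 0.
Proof.
have := mu_gibbs measurableT; rewrite probability_setT -/Z partition_fin -EFinM.
move=> [] /eqP; apply: contraTN => /eqP ->; rewrite mulr0.
by rewrite oner_eq0.
Qed.

Lemma partition_gt0 : 0 < Z.
Proof.
rewrite lt_neqAle eq_sym partition_neq0 fine_ge0// integral_ge0// => x _.
Qed.

Lemma ge0_integral_gibbs f : measurable_fun setT f -> (forall x, 0 <= f x) ->
  (\int[mu]_x (f x)%:E = (Z^-1)%:E * \int[lam]_x (f x * expR (- Phi x))%:E)%E.
Proof.
move=> mf f0; rewrite (@ge0_integral_density _ _ _ lam mu (fun x => Z^-1 * expR (- Phi x))).
- rewrite -ge0_integralZl//; last 3 first.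
  + apply/measurable_EFinP; apply: measurable_funM => //; exact: measurable_weight.
  + by move=> x _; rewrite lee_fin mulr_ge0// expR_ge0.
  + by rewrite lee_fin invr_ge0 ltW// partition_gt0.
  by apply: eq_integral => x _; rewrite -!EFinM mulrCA.
- by apply: measurable_funM; [exact: measurable_cst|exact: measurable_weight].
- move=> A mA; rewrite (mu_gibbs mA) -/Z -ge0_integralZl//.
  + apply/measurable_EFinP; apply: measurable_funTS; exact: measurable_weight.
  + by rewrite lee_fin invr_ge0 ltW// partition_gt0.
- exact/measurable_EFinP.
- by move=> x; rewrite lee_fin.
Qed.

Lemma tame_integrable f : tame f -> mu.-integrable setT (EFin \o f).
Proof.
move=> tf; apply/integrableP; split.
  by apply/measurable_EFinP; exact: tf.1.
have tn := tame_norm tf.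
have -> : (\int[mu]_x `|(EFin \o f) x|)%E = (\int[mu]_x (`|f x|)%:E)%E by [].
rewrite ge0_integral_gibbs//; last exact: tn.1.
have /integrable_fin_num : lam.-integrable setT (EFin \o (fun x => `|f x| * expR (- Phi x))).
  exact: integrable_weight.
by move=> /(_ measurableT) /fineK <-; rewrite -EFinM ltry.
Qed.

Definition mean f : R := fine (\int[mu]_x (f x)%:E)%E.

Lemma meanE f : tame f -> (\int[mu]_x (f x)%:E)%E = (mean f)%:E.
Proof. by move=> tf; rewrite fineK// integrable_fin_num//; exact: tame_integrable. Qed.

Lemma eq_mean f g : f =1 g -> mean f = mean g.
Proof. by move=> /funext ->. Qed.

Lemma meanD f g : tame f -> tame g -> mean (fun x => f x + g x) = mean f + mean g.
Proof.
move=> tf tg; apply: EFin_inj; rewrite -meanE; last exact: tameD.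
under eq_integral do rewrite EFinD.
by rewrite integralD_EFin// ?EFinD -?meanE//; exact: tame_integrable.
Qed.

Lemma mean_cst (c : R) : mean (fun=> c) = c.
Proof.
rewrite /mean integral_cst//; apply: (@congr1 _ _ fine _ c%:E).
by rewrite -[RHS]mule1; congr (_ * _)%E; exact: probability_setT.
Qed.

Lemma meanZ (c : R) f : tame f -> mean (fun x => c * f x) = c * mean f.
Proof.
move=> tf; apply: EFin_inj; rewrite -meanE; last exact: tameZ.
under eq_integral do rewrite EFinM.
by rewrite integralZl// ?EFinM -?meanE//; exact: tame_integrable.
Qed.

Lemma meanB f g : tame f -> tame g -> mean (fun x => f x - g x) = mean f - mean g.
Proof.
move=> tf tg; rewrite meanD//; last exact: tameN.
by under [X in _ + X]eq_mean do rewrite -mulN1r; rewrite meanZ// mulN1r.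
Qed.

Lemma mean_sum (I : Type) (s : seq I) (F : I -> 'rV[R]_n -> R) :
  (forall i, tame (F i)) -> mean (fun x => \sum_(i <- s) F i x) = \sum_(i <- s) mean (F i).
Proof.
move=> tF; elim: s => [|i s IH].
  by rewrite big_nil -[RHS](mean_cst 0); apply: eq_mean => x; rewrite big_nil.
rewrite big_cons -IH -meanD//; last exact: tame_sum.
by apply: eq_mean => x; rewrite big_cons.
Qed.

(** For a function f of any sign, f + |f| and |f| are nonnegative and tame. *)
Lemma mean_gibbs f : tame f ->
  mean f = Z^-1 * fine (\int[lam]_x (f x * expR (- Phi x))%:E)%E.
Proof.
move=> tf; pose g x := f x + `|f x|.
have tn := tame_norm tf; have tg : tame g by exact: tameD.
have fin h : tame h -> (\int[lam]_x (h x * expR (- Phi x))%:E)%E \is a fin_num.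
  by move=> th; exact: (integrable_fin_num measurableT (integrable_weight th)).
have pos h : tame h -> (forall x, 0 <= h x) ->
    mean h = Z^-1 * fine (\int[lam]_x (h x * expR (- Phi x))%:E)%E.
  by move=> th h0; rewrite /mean (ge0_integral_gibbs th.1 h0) fineM// fin.
have -> : mean f = mean g - mean (fun x => `|f x|).
  by rewrite -meanB//; apply: eq_mean => x; rewrite /g addrK.
rewrite !pos//; last first.
  by move=> x; rewrite /g; move: (f x) => t; have := ler_norm (- t); rewrite normrN; lra.
rewrite -mulrBr -fineB ?fin//; congr (_ * fine _).
rewrite -integralB_EFin//; [|exact: integrable_weight|exact: integrable_weight].
by apply: eq_integral => x _; rewrite -EFinB -mulrBl /g addrK.
Qed.

(** Integration by parts against the Gibbs measure: the integral of the
    derivative of F exp(-Phi) vanishes. *)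
Lemma gibbs_integration_by_parts (F dF : 'rV[R]_n -> R) i :
  continuous F -> tame F -> tame dF -> (forall x, is_derive x (e i) F (dF x)) ->
  mean dF = mean (fun x => F x * p i x).
Proof.
move=> cF tF tdF DF; pose G x := F x * expR (- Phi x).
have tFp : tame (fun x => F x * p i x) by apply: tameM => //; exact: tame_partial.
have DG x : is_derive x (e i) G ((dF x - F x * p i x) * expR (- Phi x)).
  have Dw : is_derive x (e i) (fun y => expR (- Phi y)) (- expR (- Phi x) * p i x).
    have De : is_derive (Phi x) (1 : R) (expR \o -%R) (- expR (- Phi x)).
      by apply: is_derive_eq; rewrite mulrN1.
    exact: is_derive_comp_scalar De (is_derive_potential_axis H x i).
  apply: (@is_derive_eq _ _ _ _ _ _ _ _ (is_deriveM (DF x) Dw)).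
  rewrite -[_ *: (_ * _)]/(_ * (_ * _)) -[X in _ + X = _]/(_ * _).
  move: (F x) (dF x) (p i x) (expR _) => a b c d; ring.
have cG : continuous G.
  by move=> x; exact: (cvgM (cF x) (@continuous_weight x)).
have [C1 C10 B1] := tame_weight_bound tF.
have [C2 C20 B2] := tame_weight_bound (tameB tdF tFp).
have E0 : (\int[lam]_x ('D_(e i) G x)%:E = 0)%E.
  apply: (@integral_derive0 R n G (e i) (C1 + C2)) => //.
  - move=> x; apply: (le_trans (B1 x)); rewrite mulrDl lerDl mulr_ge0// expR_ge0.
  - move=> x; have [_ ->] := DG x; apply: (le_trans (B2 x)).
    by rewrite mulrDl lerDr mulr_ge0// expR_ge0.
apply/eqP; rewrite -subr_eq0 -meanB// mean_gibbs; last exact: tameB.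
apply/eqP; rewrite (_ : (\int[lam]_x _)%E = 0%E) ?mulr0//.
rewrite -[RHS]E0; apply: eq_integral => x _; have [_ ->] := DG x.
by [].
Qed.

End gibbs.

(** * Rigidity *)

Section rigidity.
Context {R : realType} {n : nat} {Phi : 'rV[R]_n -> R} {mu : probability 'rV[R]_n R}.
Context (H : admissible Phi) (mu_gibbs : is_gibbs Phi mu).
Local Notation p := (partial Phi).
Local Notation e i := (delta_mx ord0 i : 'rV[R]_n).
Local Notation mean := (mean (mu := mu)).
Local Notation tameP := (tame_partial H).

Lemma mean_gt0 (g : 'rV[R]_n -> R) x0 : tame g -> (forall x, 0 <= g x) ->
  {for x0, continuous g} -> 0 < g x0 -> 0 < mean g.
Proof.
move=> tg g0 cg gx0; rewrite (mean_gibbs H mu_gibbs tg) mulr_gt0//.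
  by rewrite invr_gt0 (partition_gt0 H mu_gibbs).
rewrite fine_gt0//; apply/andP; split.
  apply: (integral_gt0 (x0 := x0)).
  - by apply: measurable_funM; [exact: tg.1|exact: measurable_weight].
  - by move=> x; rewrite mulr_ge0// expR_ge0.
  - exact: (cvgM cg (@continuous_weight _ _ _ H x0)).
  - by rewrite mulr_gt0// expR_gt0.
have /integrable_fin_num := integrable_weight H tg.
by move=> /(_ measurableT); rewrite fin_numElt => /andP[].
Qed.

Definition second_moment : 'M[R]_n := \matrix_(i, j) mean (fun x => p i x * p j x).

(** For u nonzero, the derivative of Phi along u does not vanish at the point u
    itself, by Euler's identity. *)
Lemma second_moment_posdef : posdef second_moment.
Proof.
split.
  apply/matrixP => i j; rewrite !mxE; apply: eq_mean => x; exact: mulrC.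
move=> u u0; pose g x := (\sum_i u ord0 i * p i x) ^+ 2.
have tg1 : tame (fun x => \sum_i u ord0 i * p i x).
  by apply: tame_sum => i; apply: tameZ; exact: tameP.
have tg : tame g.
  rewrite (_ : g = fun x => (\sum_i u ord0 i * p i x) * (\sum_i u ord0 i * p i x)).
    exact: tameM.
  by apply/funext => x; rewrite /g expr2.
rewrite quadformE.
have -> : \sum_i \sum_j u ord0 i * u ord0 j * second_moment i j = mean g.
  transitivity (mean (fun x => \sum_i \sum_j u ord0 i * u ord0 j * (p i x * p j x))).
    have tij i j : tame (fun x => p i x * p j x) by apply: tameM; exact: tameP.
    rewrite (mean_sum H mu_gibbs); last first.
      by move=> i; apply: tame_sum => j; apply: tameZ.
    apply: eq_bigr => i _; rewrite (mean_sum H mu_gibbs); last first.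
      by move=> j; apply: tameZ.
    by apply: eq_bigr => j _; rewrite (meanZ H mu_gibbs)// mxE.
  apply: eq_mean => x; rewrite /g expr2 mulr_suml; apply: eq_bigr => i _.
  rewrite mulr_sumr; apply: eq_bigr => j _; exact: mulrACA.
apply: (mean_gt0 (x0 := u)) => //; first by move=> x; exact: sqr_ge0.
  have c1 : {for u, continuous (fun x => \sum_i u ord0 i * p i x)}.
    by apply: continuous_at_sum => i; apply: continuous_at_scale; exact: partial_continuous.
  exact: (cvg_comp _ _ c1 (@exprn_continuous _ 2 _)).
by rewrite /g (euler_potential H)// exprn_gt0// mulr_gt0// (potential_gt0 H).
Qed.

(** Integration by parts with the coordinate functions. *)
Lemma mean_potential : mean (fun x => 2 * Phi x) = n%:R.
Proof.
rewrite -[X in _ = X%:R]card_ord -sumr_const.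
transitivity (mean (fun x => \sum_i x ord0 i * p i x)).
  apply: eq_mean => x; have [->|x0] := eqVneq x 0; last by rewrite euler_potential.
  by rewrite (potential0 H) mulr0 big1// => i _; rewrite mxE mul0r.
rewrite (mean_sum H mu_gibbs); last first.
  by move=> i; apply: tameM; [exact: tame_coord|exact: tameP].
apply: eq_bigr => i _.
have D (x : 'rV[R]_n) : is_derive x (e i) (fun x : 'rV[R]_n => x ord0 i) 1.
  apply: is_derive_from_line.
  rewrite (_ : (fun s : R => _) = cst (x ord0 i) + @id R).
    by apply: is_derive_eq; rewrite add0r.
  by apply/funext => s; rewrite !mxE !eqxx mulr1.
have cc : continuous (fun x : 'rV[R]_n => x ord0 i) by exact: coord_continuous.
rewrite -(gibbs_integration_by_parts H mu_gibbs cc (tame_coord i) (tame_cst 1) D).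
exact: mean_cst.
Qed.

Context (A : 'M[R]_n).

(** Derivatives of the potential along the rows of A, which are going to be an
    orthonormal basis for the second moment of the gradient, and the matrix of
    its Hessian in these directions. *)
Definition frame_grad (i : 'I_n) (x : 'rV[R]_n) : R := \sum_k A i k * p k x.
Definition frame_hess (i j : 'I_n) (x : 'rV[R]_n) : R :=
  (A *m hessian Phi x *m A^T) i j.
Local Notation y := frame_grad.
Local Notation h := frame_hess.
Local Notation dy m j x := (\sum_k A j k * hessian Phi x m k).

Lemma is_derive_frame_grad x m j : is_derive x (e m) (y j) (dy m j x).
Proof.
by apply: is_derive_scalar_sum => k; exact: is_derive_partial_axis.
Qed.

Lemma frame_grad0 i : y i 0 = 0.
Proof. by rewrite /y big1// => k _; rewrite (partial0 H) mulr0. Qed.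

Lemma tame_frame_grad i : tame (y i).
Proof. by apply: tame_sum => k; apply: tameZ; exact: tameP. Qed.

Lemma continuous_frame_grad i : continuous (y i).
Proof.
move=> x; apply: continuous_at_sum => k; apply: continuous_at_scale.
exact: partial_continuous.
Qed.

Lemma tame_dy m j : tame (fun x => dy m j x).
Proof. by apply: tame_sum => k; apply: tameZ; exact: tame_hessian. Qed.

Lemma frame_hessE i j x : h i j x = \sum_k A j k * \sum_m A i m * hessian Phi x m k.
Proof.
rewrite /h !mxE; apply: eq_bigr => k _; rewrite mulrC !mxE; congr (_ * _).
Qed.

Lemma frame_hessE' i j x : h i j x = \sum_m A i m * dy m j x.
Proof.
rewrite frame_hessE; under eq_bigr => k _ do rewrite mulr_sumr.
rewrite exchange_big; apply: eq_bigr => m _ /=; rewrite mulr_sumr.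
by apply: eq_bigr => k _; rewrite mulrCA.
Qed.

Lemma frame_hess_sym i j x : x != 0 -> h i j x = h j i x.
Proof.
move=> x0; have E : (A *m hessian Phi x *m A^T)^T = A *m hessian Phi x *m A^T.
  by rewrite !trmx_mul trmxK (hessian_sym H x0) mulmxA.
by rewrite /h -[in LHS]E mxE.
Qed.

Lemma tame_frame_hess i j : tame (h i j).
Proof.
rewrite (_ : h i j = fun x => \sum_m A i m * dy m j x); last first.
  by apply/funext => x; rewrite frame_hessE'.
by apply: tame_sum => m; apply: tameZ; exact: tame_dy.
Qed.

Lemma is_derive_frame_product x m i j :
  is_derive x (e m) (fun x => y i x * y j x) (y i x * dy m j x + y j x * dy m i x).
Proof. exact: (is_deriveM (is_derive_frame_grad x m i) (is_derive_frame_grad x m j)). Qed.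

Lemma continuous_vanish_bounded (f g : 'rV[R]_n -> R) (K L : R) : 0 <= K -> 0 <= L ->
  (forall x, `|f x| <= K * `|x|) -> (forall x, `|g x| <= L) ->
  {for 0, continuous (fun x => f x * g x)}.
Proof.
move=> K0 L0 fK gL; apply: (@continuous_at_bound R _ _ (K * L)).
- exact: mulr_ge0.
- apply/eqP; rewrite mulf_eq0; apply/orP; left.
  by rewrite -normr_le0 (le_trans (fK 0))// normr0 mulr0.
- by move=> x; rewrite normrM mulrAC ler_pM.
Qed.

Lemma frame_grad_bound i : exists2 K : R, 0 <= K & forall x, `|y i x| <= K * `|x|.
Proof.
have [K K0 HK] := partial_bound H.
exists (\sum_k `|A i k| * K); first by apply: sumr_ge0 => k _; rewrite mulr_ge0.
move=> x; rewrite mulr_suml (le_trans (ler_norm_sum _ _ _))//.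
by apply: ler_sum => k _; rewrite normrM -mulrA ler_wpM2l.
Qed.

Lemma dy_bound m j : exists2 K : R, 0 <= K & forall x, `|dy m j x| <= K.
Proof.
have [K K0 HK] := hessian_bound H.
exists (\sum_k `|A j k| * K); first by apply: sumr_ge0 => k _; rewrite mulr_ge0.
move=> x; rewrite (le_trans (ler_norm_sum _ _ _))//.
by apply: ler_sum => k _; rewrite normrM ler_wpM2l.
Qed.

(** At the origin, the vanishing of the first factor makes up for a
    discontinuity of the second, which is bounded. *)
Lemma continuous_frame_grad_dy i m j : continuous (fun x => y i x * dy m j x).
Proof.
move=> x; have [->|x0] := eqVneq x 0.
  have [K K0 HK] := frame_grad_bound i; have [L L0 HL] := dy_bound m j.
  exact: continuous_vanish_bounded HK HL.
have c2 : {for x, continuous (fun x => dy m j x)}.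
  apply: continuous_at_sum => k; apply: continuous_at_scale.
  rewrite (_ : (fun x => _) = partial (p k) m); first exact: partial2_continuous.
  by apply/funext => z; rewrite mxE.
exact: (cvgM (@continuous_frame_grad i x) c2).
Qed.

Lemma frame_product_C1 i j : Ck 1 setT (fun x => y i x * y j x).
Proof.
split.
  by move=> x _; exact: (cvgM (@continuous_frame_grad i x) (@continuous_frame_grad j x)).
move=> m; split; first by move=> x _; have [] := is_derive_frame_product x m i j.
split=> // x _.
rewrite (_ : partial _ m = fun x => y i x * dy m j x + y j x * dy m i x).
  exact: (cvgD (@continuous_frame_grad_dy i m j x) (@continuous_frame_grad_dy j m i x)).
by apply/funext => z; have [_ E] := is_derive_frame_product z m i j; exact: E.
Qed.

Lemma frame_product_even i j : even_fun (fun x => y i x * y j x).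
Proof.
have yN k x : y k (- x) = - y k x.
  by rewrite /y -sumrN; apply: eq_bigr => l _; rewrite (partial_odd H) mulrN.
by move=> x; rewrite !yN mulrNN.
Qed.

Lemma quadform_hessian_frame x (v : 'rV[R]_n) :
  quadform (hessian Phi x) (v *m A) = \sum_i \sum_j v ord0 i * v ord0 j * h i j x.
Proof. by rewrite -quadform_congr quadformE. Qed.

Lemma hessian_swap x i j : x != 0 -> hessian Phi x i j = hessian Phi x j i.
Proof. by move=> x0; have /matrixP/(_ j i) := hessian_sym H x0; rewrite [LHS]mxE. Qed.

Lemma dy_row x m j : x != 0 -> dy m j x = (row j A *m hessian Phi x) ord0 m.
Proof.
move=> x0; rewrite [RHS]mxE; apply: eq_bigr => k _.
by rewrite (hessian_swap m k x0) [row _ _ _ _]mxE.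
Qed.

(** The gradient is u *m hessian Phi x with u = y_i a_j + y_j a_i, where a_i is
    the i-th row of A, so the inverse Hessian cancels. *)
Lemma energy_frame_product x i j :
  quadform (invmx (hessian Phi x)) (grad (fun x => y i x * y j x) x) =
  y i x ^+ 2 * h j j x + y j x ^+ 2 * h i i x + 2 * (y i x * y j x * h j i x).
Proof.
have gE : grad (fun x => y i x * y j x) x =
    \row_m (y i x * dy m j x + y j x * dy m i x).
  apply/rowP => m; rewrite !mxE /partial.
  by have [_ ->] := is_derive_frame_product x m i j.
have [x0|x0] := eqVneq x 0.
  rewrite gE x0 !frame_grad0 expr0n /= !mul0r !mulr0 !addr0 (_ : \row_m _ = 0).
    by rewrite /quadform !mul0mx mxE.
  by apply/rowP => m; rewrite !mxE !mul0r addr0.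
pose u : 'rV[R]_n := y i x *: row j A + y j x *: row i A.
have guE : grad (fun x => y i x * y j x) x = u *m hessian Phi x.
  rewrite gE; apply/rowP => m; rewrite [LHS]mxE !dy_row// /u mulmxDl -!scalemxAl.
  by move: (row j A *m _) (row i A *m _) => a b; rewrite !mxE.
have uH : hessian Phi x \in unitmx by rewrite unitmxE unitfE gt_eqF// (adm_det H).
rewrite guE.
have -> : quadform (invmx (hessian Phi x)) (u *m hessian Phi x) = quadform (hessian Phi x) u.
  by rewrite /quadform trmx_mul (hessian_sym H x0) mulmxA mulmxK.
have -> : u = (y i x *: e j + y j x *: e i) *m A.
  by rewrite mulmxDl -!scalemxAl -!rowE.
rewrite -quadform_congr quadform_delta2 -/(h j j x) -/(h i i x) -/(h i j x) -/(h j i x).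
by rewrite (frame_hess_sym i j x0); move: (h _ _ _) (h _ _ _) (h _ _ _) => a b c; ring.
Qed.

(** The inequality in real numbers. For tame functions every integral in it is
    finite. *)
Lemma strong_brascamp_lieb_mean (f q : 'rV[R]_n -> R) :
  strong_brascamp_lieb Phi mu -> Ck 1 setT f -> even_fun f -> tame f -> tame q ->
  (forall x, quadform (invmx (hessian Phi x)) (grad f x) = q x) ->
  mean (fun x => f x * f x) - mean f ^+ 2 <= 2^-1 * mean q.
Proof.
move=> BL C1 ef tf tq qE; have tff : tame (fun x => f x * f x) by exact: tameM.
have Lf : f \in Lfun mu 2%:E.
  apply: integrable_sqr_Lfun; first exact: tf.1.
  exact: (tame_integrable H mu_gibbs tff).
have := BL f C1 Lf ef; rewrite varianceE// unlock.
under [X in (_ <= _ * X)%E]eq_integral => x _ do rewrite qE.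
rewrite (meanE H mu_gibbs tq) (meanE H mu_gibbs tf).
rewrite -[X in (X - _ <= _)%E]/(\int[mu]_x (f x * f x)%:E)%E (meanE H mu_gibbs tff).
by rewrite -!EFinM -EFinB lee_fin.
Qed.

Context (A_white : A *m second_moment *m A^T = 1%:M).

Lemma mean_frame_product i j : mean (fun x => y i x * y j x) = (i == j)%:R.
Proof.
have <- : (A *m second_moment *m A^T) i j = (i == j)%:R by rewrite A_white mxE.
rewrite mxE.
transitivity (mean (fun x => \sum_l A j l * \sum_k A i k * (p k x * p l x))).
  apply: eq_mean => x; rewrite /y mulrC mulr_suml; apply: eq_bigr => l _.
  rewrite -mulrA; congr (_ * _); rewrite mulr_sumr; apply: eq_bigr => k _.
  by rewrite mulrCA [p l x * _]mulrC.
have tkl k l : tame (fun x => p k x * p l x) by apply: tameM; exact: tameP.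
have t1 l : tame (fun x => \sum_k A i k * (p k x * p l x)).
  by apply: tame_sum => k; apply: tameZ.
rewrite (mean_sum H mu_gibbs); last by move=> l; exact: tameZ.
apply: eq_bigr => l _; rewrite (meanZ H mu_gibbs)// (mean_sum H mu_gibbs); last first.
  by move=> k; apply: tameZ.
rewrite mulrC; congr (_ * _); last by rewrite mxE.
by rewrite mxE; apply: eq_bigr => k _; rewrite (meanZ H mu_gibbs)// mxE.
Qed.

(** Integration by parts for the cubic [y i ^+ 2 * y j] along the j-th frame
    vector. *)
Lemma mean_quartic i j :
  mean (fun x => (y i x * y j x) * (y i x * y j x)) =
  2 * mean (fun x => y i x * y j x * h j i x) + mean (fun x => y i x ^+ 2 * h j j x).
Proof.
pose F x := y i x * y j x * y i x.
pose dF m x := y i x * y j x * dy m i x + y i x * (y i x * dy m j x + y j x * dy m i x).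
have DF m x : is_derive x (e m) F (dF m x).
  exact: (is_deriveM (is_derive_frame_product x m i j) (is_derive_frame_grad x m i)).
have ty := tame_frame_grad; have tij : tame (fun x => y i x * y j x) by exact: tameM.
have tF : tame F by exact: tameM.
have tdF m : tame (dF m).
  apply: tameD; first by apply: tameM => //; exact: tame_dy.
  by apply: tameM => //; apply: tameD; apply: tameM => //; exact: tame_dy.
have cF : continuous F.
  move=> x; have c1 : {for x, continuous (fun x => y i x * y j x)}.
    exact: (cvgM (@continuous_frame_grad i x) (@continuous_frame_grad j x)).
  exact: (cvgM c1 (@continuous_frame_grad i x)).
transitivity (mean (fun x => \sum_m A j m * (F x * p m x))).
  apply: eq_mean => x; rewrite {4}/y /F mulrA mulr_sumr; apply: eq_bigr => m _.
  exact: mulrCA.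
have tFp m : tame (fun x => F x * p m x) by apply: tameM => //; exact: tameP.
rewrite (mean_sum H mu_gibbs); last by move=> m; exact: tameZ.
transitivity (mean (fun x => \sum_m A j m * dF m x)).
  rewrite (mean_sum H mu_gibbs); last by move=> m; exact: tameZ.
  apply: eq_bigr => m _; rewrite !(meanZ H mu_gibbs)//.
  by rewrite (gibbs_integration_by_parts H mu_gibbs cF tF (tdF m) (DF m)).
have t1 : tame (fun x => y i x * y j x * h j i x) by apply: tameM => //; exact: tame_frame_hess.
have t2 : tame (fun x => y i x ^+ 2 * h j j x).
  apply: tameM; last exact: tame_frame_hess.
  by rewrite (_ : (fun x => _) = fun x => y i x * y i x); [exact: tameM|apply/funext => x].
rewrite -(meanZ H mu_gibbs)// -(meanD H mu_gibbs)//; last exact: tameZ.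
apply: eq_mean => x; rewrite !frame_hessE' /dF.
transitivity (\sum_m (2 * (y i x * y j x) * (A j m * dy m i x) + y i x ^+ 2 * (A j m * dy m j x))).
  apply: eq_bigr => m _; move: (y i x) (y j x) (A j m) (dy m i x) (dy m j x) => a b c d f; ring.
by rewrite big_split /= -!mulr_sumr [2 * (_ * _ * _)]mulrA.
Qed.

Lemma tame_frame_energy i j : tame (fun x => y i x * y j x * h j i x).
Proof.
apply: tameM; last exact: tame_frame_hess.
by apply: tameM; exact: tame_frame_grad.
Qed.

Lemma tame_frame_trace i j : tame (fun x => y i x ^+ 2 * h j j x).
Proof.
apply: tameM; last exact: tame_frame_hess.
rewrite (_ : (fun x => _) = fun x => y i x * y i x); last by apply/funext => x.
by apply: tameM; exact: tame_frame_grad.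
Qed.

(** The inequality for [y i * y j] reads Q i j <= (i == j)%:R + (T j i - T i j) / 2
    once [mean_quartic] has removed the quartic mean; in the sum over i and j the
    terms T cancel. *)
Lemma frame_energy_le : strong_brascamp_lieb Phi mu ->
  \sum_i \sum_j mean (fun x => y i x * y j x * h j i x) <= n%:R.
Proof.
move=> BL; pose Q i j := mean (fun x => y i x * y j x * h j i x).
pose T i j := mean (fun x => y i x ^+ 2 * h j j x).
have Qij i j : Q i j <= (i == j)%:R + 2^-1 * (T j i - T i j).
  have te := tame_frame_energy i j; have t1 := tame_frame_trace i j.
  have t2 := tame_frame_trace j i.
  have t2e : tame (fun x => 2 * (y i x * y j x * h j i x)) by exact: tameZ.
  have tq : tame (fun x => y i x ^+ 2 * h j j x + y j x ^+ 2 * h i i x +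
      2 * (y i x * y j x * h j i x)).
    by apply: tameD => //; exact: tameD.
  have tf : tame (fun x => y i x * y j x) by apply: tameM; exact: tame_frame_grad.
  have := strong_brascamp_lieb_mean BL (frame_product_C1 i j) (frame_product_even i j)
    tf tq (fun x => energy_frame_product x i j).
  rewrite mean_quartic mean_frame_product (meanD H mu_gibbs)//; last exact: tameD.
  rewrite (meanD H mu_gibbs)// (meanZ H mu_gibbs)// -/(Q i j) -/(T i j) -/(T j i).
  have -> : ((i == j)%:R : R) ^+ 2 = (i == j)%:R by case: eqP; rewrite ?expr1n ?expr0n.
  by move: (Q i j) (T i j) (T j i) ((i == j)%:R) => a b c d; lra.
apply: (@le_trans _ _ (\sum_i \sum_j ((i == j)%:R + 2^-1 * (T j i - T i j)))).
  by apply: ler_sum => i _; apply: ler_sum => j _; exact: Qij.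
have -> : \sum_(i < n) \sum_(j < n) ((i == j)%:R + 2^-1 * (T j i - T i j)) =
    \sum_(i < n) \sum_(j < n) (i == j)%:R + 2^-1 * (\sum_(i < n) \sum_(j < n) T j i - \sum_(i < n) \sum_(j < n) T i j).
  rewrite -sumrB mulr_sumr -big_split /=; apply: eq_bigr => i _.
  rewrite -sumrB mulr_sumr -big_split /=; apply: eq_bigr => j _; by [].
rewrite [\sum_i \sum_j T j i]exchange_big subrr mulr0 addr0.
rewrite (eq_bigr (fun=> 1)); first by rewrite sumr_const card_ord.
move=> i _; rewrite (bigD1 i)//= eqxx big1 ?addr0// => j /negPf ji.
by rewrite eq_sym ji.
Qed.

Definition frame_row (x : 'rV[R]_n) : 'rV[R]_n := grad Phi x *m A^T.

Lemma frame_rowE x i : frame_row x ord0 i = y i x.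
Proof. by rewrite mxE; apply: eq_bigr => k _; rewrite !mxE mulrC. Qed.

Lemma euler_row x : x != 0 -> x *m hessian Phi x = grad Phi x.
Proof. by move=> x0; apply/rowP => j; rewrite !mxE -(euler_partial H)//; apply: eq_bigr. Qed.

Lemma euler_row_potential x : x != 0 -> (grad Phi x *m x^T) ord0 ord0 = 2 * Phi x.
Proof.
move=> x0; rewrite -(euler_potential H x0) mxE; apply: eq_bigr => i _.
by rewrite !mxE mulrC.
Qed.

(** The squared length, in the Hessian metric, of the difference between x and
    the dual vector of the gradient; see [defectE]. Written out this way, it is
    tame and its mean can be computed term by term. *)
Definition defect x :=
  \sum_i \sum_j y i x * y j x * h i j x - 2 * \sum_i y i x * y i x + 2 * Phi x.

Lemma defectE x : x != 0 ->
  defect x = quadform (hessian Phi x) (frame_row x *m A - x).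
Proof.
move=> x0; set z := frame_row x *m A; set D := hessian Phi x.
have zz : quadform D z = \sum_i \sum_j y i x * y j x * h i j x.
  rewrite /z quadform_hessian_frame.
  by apply: eq_bigr => i _; apply: eq_bigr => j _; rewrite !frame_rowE.
have xz : (x *m D *m z^T) ord0 ord0 = \sum_i y i x * y i x.
  rewrite (euler_row x0) /z trmx_mul mulmxA -/(frame_row x) mxE.
  by apply: eq_bigr => i _; rewrite [_^T _ _]mxE frame_rowE.
have xx : quadform D x = 2 * Phi x.
  by rewrite /quadform (euler_row x0) euler_row_potential.
by rewrite quadform_sub ?(hessian_sym H x0)// xz xx /defect -zz.
Qed.

Lemma defect0 : defect 0 = 0.
Proof.
rewrite /defect (potential0 H) mulr0 addr0 !big1 ?mulr0 ?subr0// => i _.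
  by rewrite frame_grad0 mul0r.
by rewrite big1// => j _; rewrite frame_grad0 !mul0r.
Qed.

Lemma defect_ge0 x : 0 <= defect x.
Proof.
have [->|x0] := eqVneq x 0; first by rewrite defect0.
by rewrite defectE// (hessian_psd H).
Qed.

Lemma defect_continuous x : x != 0 -> {for x, continuous defect}.
Proof.
move=> x0; have cy i : {for x, continuous (y i)} by exact: continuous_frame_grad.
have ch i j : {for x, continuous (h i j)}.
  rewrite (_ : h i j = fun x => \sum_k A j k * \sum_m A i m * partial (p k) m x).
    apply: continuous_at_sum => k; apply: continuous_at_scale.
    apply: continuous_at_sum => m; apply: continuous_at_scale.
    exact: partial2_continuous.
  apply/funext => z; rewrite frame_hessE; apply: eq_bigr => k _; congr (_ * _).
  by apply: eq_bigr => m _; rewrite mxE.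
have c1 : {for x, continuous (fun x => \sum_i \sum_j y i x * y j x * h i j x)}.
  apply: continuous_at_sum => i; apply: continuous_at_sum => j.
  have cyy : {for x, continuous (fun x => y i x * y j x)} by exact: (cvgM (cy i) (cy j)).
  exact: (cvgM cyy (ch i j)).
have c2 : {for x, continuous (fun x => 2 * \sum_i y i x * y i x)}.
  apply: continuous_at_scale; apply: continuous_at_sum => i.
  exact: (cvgM (cy i) (cy i)).
have c3 : {for x, continuous (fun x => 2 * Phi x)}.
  by apply: continuous_at_scale; exact: potential_continuousT.
exact: (cvgD (cvgB c1 c2) c3).
Qed.

Lemma tame_frame_energy_swap i j : tame (fun x => y i x * y j x * h i j x).
Proof.
apply: tameM; last exact: tame_frame_hess.
by apply: tameM; exact: tame_frame_grad.
Qed.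

Lemma tame_defect : tame defect.
Proof.
apply: tameD; last by apply: tameZ; exact: tame_potential.
apply: tameB.
  by apply: tame_sum => i; apply: tame_sum => j; exact: tame_frame_energy_swap.
by apply: tameZ; apply: tame_sum => i; apply: tameM; exact: tame_frame_grad.
Qed.

Lemma mean_defect_le0 : strong_brascamp_lieb Phi mu -> mean defect <= 0.
Proof.
move=> BL.
have t1 : tame (fun x => \sum_i \sum_j y i x * y j x * h i j x).
  by apply: tame_sum => i; apply: tame_sum => j; exact: tame_frame_energy_swap.
have tyy i : tame (fun x => y i x * y i x) by apply: tameM; exact: tame_frame_grad.
have t2 : tame (fun x => \sum_i y i x * y i x) by exact: tame_sum.
have t3 : tame (fun x => 2 * Phi x) by apply: tameZ; exact: tame_potential.
have t2' : tame (fun x => 2 * \sum_i y i x * y i x) by exact: tameZ.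
rewrite /defect (meanD H mu_gibbs)//; last exact: tameB.
rewrite (meanB H mu_gibbs)// mean_potential (meanZ H mu_gibbs)//.
have -> : mean (fun x => \sum_i y i x * y i x) = n%:R.
  rewrite (mean_sum H mu_gibbs)// (eq_bigr (fun=> 1)); last first.
    by move=> i _; rewrite mean_frame_product eqxx.
  by rewrite sumr_const card_ord.
have -> : mean (fun x => \sum_i \sum_j y i x * y j x * h i j x) =
    \sum_i \sum_j mean (fun x => y i x * y j x * h j i x).
  rewrite (mean_sum H mu_gibbs); last first.
    by move=> i; apply: tame_sum => j; exact: tame_frame_energy_swap.
  rewrite [RHS]exchange_big; apply: eq_bigr => i _ /=.
  rewrite (mean_sum H mu_gibbs); last by move=> j; exact: tame_frame_energy_swap.
  by apply: eq_bigr => j _; apply: eq_mean => x; rewrite [y i x * _]mulrC.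
have := frame_energy_le BL; move: (\sum_i _) (n%:R) => a b; lra.
Qed.

(** A nonnegative function of nonpositive mean vanishes where it is continuous. *)
Lemma gradient_linear x : strong_brascamp_lieb Phi mu -> x != 0 ->
  frame_row x *m A = x.
Proof.
move=> BL x0; apply/eqP; rewrite -subr_eq0; apply: contraT => zx.
have gx : 0 < defect x.
  by rewrite defectE//; have [_] := hessian_posdef H x0; apply.
have := mean_gt0 tame_defect defect_ge0 (defect_continuous x0) gx.
by rewrite ltNge mean_defect_le0.
Qed.

(** The gradient is x *m second_moment, and Euler's identity integrates it. *)
Lemma potential_quadratic x : strong_brascamp_lieb Phi mu ->
  Phi x = quadform (2^-1 *: second_moment) x.
Proof.
move=> BL; have [->|x0] := eqVneq x 0.
  by rewrite (potential0 H) /quadform !mul0mx mxE.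
have AM : A^T *m A *m second_moment = 1%:M.
  have E : second_moment *m A^T *m A = 1%:M by apply: mulmx1C; rewrite mulmxA.
  have [sM _] := second_moment_posdef.
  by rewrite -trmx1 -E !trmx_mul trmxK sM mulmxA.
have pE : grad Phi x = x *m second_moment.
  by rewrite -{2}(gradient_linear BL x0) /frame_row -!mulmxA (mulmxA A^T) AM mulmx1.
have := euler_row_potential x0; rewrite pE => E.
by rewrite /quadform -scalemxAr -scalemxAl mxE E mulKf.
Qed.

End rigidity.

Lemma posdef_scale (R : realType) (n : nat) (c : R) (M : 'M[R]_n) :
  0 < c -> posdef M -> posdef (c *: M).
Proof.
move=> c0 [sM pM]; split; first by rewrite linearZ /= sM.
by move=> u u0; rewrite /quadform -scalemxAr -scalemxAl mxE mulr_gt0// pM.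
Qed.

Theorem theorem1p13 (R : realType) (n : nat) (Phi : 'rV[R]_n -> R)
    (mu : probability 'rV[R]_n R)
    (Phi_homogeneous : homogeneous2 Phi)
    (Phi_convex : @convex_function R 'rV[R]_n setT Phi)
    (Phi_even : even_fun Phi)
    (Phi_C3 : Ck 3 [set x | x != 0] Phi)
    (Phi_det : forall x, x != 0 -> 0 < \det (hessian Phi x))
    (mu_gibbs : is_gibbs Phi mu)
    (mu_BL : strong_brascamp_lieb Phi mu) :
  gaussian mu /\ posdef_quadratic_form Phi.
Proof.
have H := Admissible Phi_homogeneous Phi_convex Phi_even Phi_C3 Phi_det.
have pM := second_moment_posdef H mu_gibbs.
have [A AM] := posdef_whitening pM.
pose Q := 2^-1 *: second_moment (Phi := Phi) (mu := mu).
have pQ : posdef Q by apply: posdef_scale pM; rewrite invr_gt0.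
have PhiQ x : Phi x = quadform Q x by exact: (potential_quadratic H mu_gibbs AM).
split; last by exists Q.
exists 0, Q; split; first exact: pQ.
rewrite (_ : (fun x => _) = Phi)//; apply/funext => x.
by rewrite subr0 PhiQ.
Qed.
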